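(* Let $\{f_i\}_{i\in\mathbb{N}}$ be a linearly independent set of a (separable) Hilbert space $H$, let $\{e_i\}_{i\in\mathbb{N}}$ be an orthonormal basis of $l_2$, and suppose that the linear operator $F:l_2\to H$ determined by $F(e_i)=f_i$, $i\in\mathbb{N}$, is bounded and that the operator $I-|F|$ is Hilbert-Schmidt. Let $F=W|F|$ be the polar decomposition of $F$. (1) There exists a symmetric orthogonalization $\{\nu_i\}_{i\in\mathbb{N}}$ of $\{f_i\}_{i\in\mathbb{N}}$ in $H$ if and only if $\dim((\operatorname{ran}F)^\perp)\ge\dim(\ker F)$. In this case, setting $\nu_i=(V+W)(e_i)$ for $i\in\mathbb{N}$, with any partial isometry $V:l_2\to H$ with initial space $\ker|F|$ and $\operatorname{ran}V\perp\operatorname{ran}W=\operatorname{ran}F$, yields a symmetric orthogonalization. Moreover, all symmetric orthogonalizations of $\{f_i\}_{i\in\mathbb{N}}$ arise in this way. (2) The set $\{f_i\}_{i\in\mathbb{N}}$ possesses a unique symmetric orthogonalization $\{\nu_i\}_{i\in\mathbb{N}}$ if and only if $\ker F=\{0\}$, if and only if the sets $\{\nu_i\}_{i\in\mathbb{N}}$ and $\{f_i\}_{i\in\mathbb{N}}$ span the same Hilbert subspace of $H$. In this case, $\nu_i=W(e_i)$ for any $i\in\mathbb{N}$ and $V=0$. (3) In other words, the linearly independent set $\{f_i\}_{i\in\mathbb{N}}$ is a frame (and, therefore, a Riesz basis) for the Hilbert subspace it spans if and only if $\ker F=\{0\}$.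
   Context: Hilbert spaces are complex; a Hilbert subspace is a closed linear subspace, and the Hilbert subspace spanned by a set is its closed linear span. Linear independence means that every finite subfamily is linearly independent. In the polar decomposition $F=W|F|$, $|F|=(F^*F)^{1/2}$ acts on $l_2$ and $W:l_2\to H$ is the partial isometry with initial space $\ker(F)^\perp$ and range the closure of $\operatorname{ran}(F)$. $I$ is the identity on $l_2$. An orthonormal basis $\{\nu_i\}_{i\in\mathbb{N}}$ of a Hilbert subspace $L\subseteq H$ is a symmetric orthogonalization of $\{f_i\}_{i\in\mathbb{N}}$ if $\sum_{j=1}^\infty\|\mu_j-f_j\|^2\ge\sum_{j=1}^\infty\|\nu_j-f_j\|^2$ for all orthonormal sets $\{\mu_i\}_{i\in\mathbb{N}}$ in Hilbert subspaces of $H$, and the right-hand sum is finite. A family $\{f_i\}_{i\in\mathbb{N}}\subset K$ is a frame of a Hilbert subspace $K$ if there are constants $C,D>0$ with $C\|x\|^2\le\sum_j|\langle x,f_j\rangle|^2\le D\|x\|^2$ for all $x\in K$. A Riesz basis of $K$ is a basis of $K$ that is at the same time a frame of $K$ (equivalently, the image of an orthonormal basis under an invertible bounded linear operator).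
   Formalization: Part (3) is proved as ''frame and Riesz basis iff ker F = {0}''; with ''frame'' alone it fails: F the projection of l_2 onto v^⊥ (v a unit vector with infinitely many nonzero coordinates) gives a linearly independent Parseval frame of v^⊥ with ker F ≠ {0}. *)

(* Defs.v *)
From HB Require Import structures.
From mathcomp Require Import all_boot all_order all_algebra sesquilinear.
From mathcomp Require Import complex.
From mathcomp Require Import all_classical all_reals all_analysis.
From mathcomp Require Import ring lra.

Set Implicit Arguments.
Unset Strict Implicit.
Unset Printing Implicit Defensive.
Import Order.TTheory GRing.Theory Num.Theory Num.Def.
Import numFieldNormedType.Exports.
Local Open Scope classical_set_scope.
Local Open Scope ring_scope.
Local Open Scope complex_scope.

(* Inner products are linear in the first argument and conjugate linear in the
   second one. *)
HB.mixin Record CompleteNormedModule_isHilbert (R : realType) H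
    & CompleteNormedModule R[i] H := {
  inner : {dot H for conjC};
  sqr_normE : forall x : H, `|x| ^+ 2 = inner x x
}.

#[short(type="hilbertType")]
HB.structure Definition Hilbert (R : realType) :=
  {H of CompleteNormedModule_isHilbert R H & CompleteNormedModule R[i] H}.

(* The norm of a module over R[i] takes its values in R[i]; rnorm is the same
   number seen in R (see rnormE). *)
Definition rnorm (R : realType) (V : normedZmodType R[i]) (x : V) : R :=
  complex.Re `|x|.

Lemma rnormE (R : realType) (V : normedZmodType R[i]) (x : V) :
  (rnorm x)%:C = `|x|.
Proof. by rewrite /rnorm RRe_real // normr_real. Qed.

Section complex_series.
Variable R : realType.
Implicit Types (z w : R[i]) (u v : nat -> R[i]).

Lemma rnorm_sqE z : rnorm z ^+ 2 = complex.Re z ^+ 2 + complex.Im z ^+ 2.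
Proof. by rewrite /rnorm normc_def /= sqr_sqrtr // addr_ge0 // sqr_ge0. Qed.

Lemma Re_add z w : complex.Re (z + w) = complex.Re z + complex.Re w.
Proof. by case: z w => [? ?] []. Qed.

Lemma Im_add z w : complex.Im (z + w) = complex.Im z + complex.Im w.
Proof. by case: z w => [? ?] []. Qed.

Lemma Re_mul z w : complex.Re (z * w) =
  complex.Re z * complex.Re w - complex.Im z * complex.Im w.
Proof. by case: z w => [? ?] []. Qed.

Lemma Im_mul z w : complex.Im (z * w) =
  complex.Re z * complex.Im w + complex.Im z * complex.Re w.
Proof. by case: z w => [? ?] []. Qed.

Lemma Re_conj z : complex.Re (conjC z) = complex.Re z.
Proof. by case: z. Qed.

Lemma Im_conj z : complex.Im (conjC z) = - complex.Im z.
Proof. by case: z. Qed.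

Definition csummable u :=
  cvgn (series (@complex.Re R \o u)) /\ cvgn (series (@complex.Im R \o u)).

Definition csum u : R[i] :=
  limn (series (@complex.Re R \o u)) +i* limn (series (@complex.Im R \o u)).

Lemma csumD u v : csummable u -> csummable v ->
  csum (fun n => u n + v n) = csum u + csum v.
Proof.
move=> [ur ui] [vr vi]; rewrite /csum.
rewrite (_ : @complex.Re R \o _ = (@complex.Re R \o u) + (@complex.Re R \o v)); last first.
  by apply/funext => n /=; rewrite Re_add.
rewrite (_ : @complex.Im R \o _ = (@complex.Im R \o u) + (@complex.Im R \o v)); last first.
  by apply/funext => n /=; rewrite Im_add.
by rewrite !lim_seriesD.
Qed.

Lemma csumZ c u : csummable u -> csum (fun n => c * u n) = c * csum u.
Proof.
move=> [ur ui]; rewrite /csum.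
rewrite (_ : @complex.Re R \o _ = complex.Re c *: (@complex.Re R \o u)
    - complex.Im c *: (@complex.Im R \o u)); last first.
  by apply/funext => n /=; rewrite Re_mul.
rewrite (_ : @complex.Im R \o (fun n => c * u n) =
    complex.Re c *: (@complex.Im R \o u) + complex.Im c *: (@complex.Re R \o u));
  last first.
  by apply/funext => n /=; rewrite Im_mul.
have cZ k f : cvgn (series f) -> cvgn (series (k *: f : nat -> R)).
  exact: is_cvg_seriesZ.
have [rr ri ir ii] := And4 (cZ (complex.Re c) _ ur) (cZ (complex.Re c) _ ui)
  (cZ (complex.Im c) _ ur) (cZ (complex.Im c) _ ui).
rewrite (lim_seriesB rr ii) (lim_seriesD ri ir) !lim_seriesZ //.
by case: c {rr ri ir ii}.
Qed.

Lemma csumJ u : csummable u -> csum (fun n => conjC (u n)) = conjC (csum u).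
Proof.
move=> [ur ui]; rewrite /csum.
rewrite (_ : @complex.Re R \o _ = @complex.Re R \o u); last first.
  by apply/funext => n /=; rewrite Re_conj.
rewrite (_ : @complex.Im R \o (fun n => conjC (u n)) = - (@complex.Im R \o u));
  last first.
  by apply/funext => n /=; rewrite Im_conj.
by rewrite lim_seriesN.
Qed.

Definition square_summable : pred (nat -> R[i]) :=
  fun a => `[< cvgn (series (fun n => rnorm (a n) ^+ 2)) >].

Lemma square_summableP a : reflect (cvgn (series (fun n => rnorm (a n) ^+ 2)))
  (a \in square_summable).
Proof. exact: asboolP. Qed.

Lemma square_summable_submod_closed : submod_closed square_summable.
Proof.
split=> [|c a b /square_summableP sa /square_summableP sb].
  apply/square_summableP.
  rewrite (_ : series _ = fun=> 0); first exact: is_cvg_cst.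
  by apply/funext => n; rewrite /series /= big1 // => k _;
    rewrite rnorm_sqE /= expr0n addr0.
apply/square_summableP.
pose v := (2 * rnorm c ^+ 2) *: (fun n => rnorm (a n) ^+ 2)
  + 2 *: (fun n => rnorm (b n) ^+ 2).
apply: (@series_le_cvg _ _ v) => [n|n|n|]; rewrite /v.
- exact: sqr_ge0.
- rewrite !fctE; apply: addr_ge0; apply: mulr_ge0; rewrite ?sqr_ge0 //.
  by rewrite mulr_ge0 ?sqr_ge0.
- rewrite !fctE !rnorm_sqE /GRing.scale/= !Re_add !Im_add !Re_mul !Im_mul.
  case: {v}c (a n) (b n) => cr ci [ar ai] [br bi] /=.
  have := sqr_ge0 (cr * ar - ci * ai - br).
  have := sqr_ge0 (cr * ai + ci * ar - bi).
  rewrite -subr_ge0 => h1; rewrite -subr_ge0 => h2.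
  rewrite -subr_ge0; apply: le_trans (addr_ge0 h1 h2) _.
  by rewrite !subr0 le_eqVlt; apply/orP; left; apply/eqP; ring.
- by apply: is_cvg_seriesD; exact: is_cvg_seriesZ.
Qed.

HB.instance Definition _ := GRing.isSubmodClosed.Build R[i] (nat -> R[i])
  square_summable square_summable_submod_closed.

End complex_series.

Record l2 (R : realType) := L2 {
  l2seq :> nat -> R[i]; _ : l2seq \in @square_summable R }.

Section l2.
Variable R : realType.
HB.instance Definition _ := [isSub for @l2seq R].
HB.instance Definition _ := [Choice of l2 R by <:].
HB.instance Definition _ := [SubChoice_isSubLmodule of l2 R by <:].
End l2.

Section cauchy_schwarz.
Variables (R : realType) (U : lmodType R[i]) (form : {dot U for conjC}).

Lemma dot_cauchy_schwarz u v :
  `|form u v| ^+ 2 <= form u u * form v v.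
Proof.
have [->|v0] := eqVneq v 0; first by rewrite !linear0r normr0 expr0n lexx.
have pv : 0 < form v v by rewrite dnorm_gt0.
have := dnorm_ge0 form (form v v *: u - form u v *: v).
rewrite dnormB !dnormZ !linearZl_LR !linearZr_LR /=.
have vv : conjC (form v v) = form v v by rewrite geC0_conj // ltW.
rewrite !rmorphM /= conjCK vv (ger0_norm (ltW pv)).
rewrite (_ : _ - _ = form v v * (form u u * form v v - `|form u v| ^+ 2)).
  by rewrite pmulr_rge0 // subr_ge0.
by rewrite normCK -[_ *: _]/(_ * _); ring.
Qed.

Lemma dot_triangle u v :
  sqrtC (form (u + v) (u + v)) <= sqrtC (form u u) + sqrtC (form v v).
Proof.
have ge0 x : 0 <= sqrtC (form x x) by rewrite sqrtC_ge0 dnorm_ge0.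
rewrite -(@ler_pXn2r _ 2) ?nnegrE ?addr_ge0 ?ge0 //.
rewrite sqrrD !sqrtCK dnormD -addrA [leRHS]addrAC -addrA lerD2l lerD2l.
have -> : form u v + conjC (form u v) = 2%:R * 'Re (form u v).
  by rewrite ReE mulrCA mulfV ?mulr1 ?pnatr_eq0 // addrC.
rewrite -[X in _ <= X]mulr_natl ler_pM2l ?ltr0n //.
apply: le_trans (leif_Re_Creal _).1 _.
rewrite -(@ler_pXn2r _ 2) ?nnegrE ?mulr_ge0 ?ge0 //.
by rewrite exprMn !sqrtCK dot_cauchy_schwarz.
Qed.

End cauchy_schwarz.

Section l2_hilbert.
Variable R : realType.
Implicit Types x y : l2 R.

Lemma l2_cvg x : cvgn (series (fun n => rnorm (x n) ^+ 2)).
Proof. by case: x => a /= /square_summableP. Qed.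

Lemma l2_mul_summable x y : csummable (fun n => x n * conjC (y n)).
Proof.
have sxy : cvgn (series ((fun n => rnorm (x n) ^+ 2) + (fun n => rnorm (y n) ^+ 2))).
  by apply: is_cvg_seriesD; exact: l2_cvg.
have hr (a b c d : R) : `|a * c - b * d| <= a ^+ 2 + b ^+ 2 + (c ^+ 2 + d ^+ 2).
  have := (sqr_ge0 (a - c), sqr_ge0 (a + c), sqr_ge0 (b - d), sqr_ge0 (b + d)).
  by move=> [[[]]]; rewrite ler_norml => *; apply/andP; split; nra.
split; apply: normed_cvg; apply: (series_le_cvg _ _ _ sxy) => n //=.
- by rewrite fctE addr_ge0 ?sqr_ge0.
- rewrite fctE !rnorm_sqE Re_mul Re_conj Im_conj.
  by apply: le_trans (hr _ _ _ _) _; rewrite sqrrN.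
- by rewrite fctE addr_ge0 ?sqr_ge0.
- rewrite fctE !rnorm_sqE Im_mul Re_conj Im_conj mulrN -normrN opprD opprK.
  by apply: le_trans (hr _ _ _ _) _; lra.
Qed.

Definition l2_inner x y := csum (fun n => x n * conjC (y n)).

Lemma l2_innerC x y : l2_inner x y = conjC (l2_inner y x).
Proof.
rewrite /l2_inner -csumJ; last exact: l2_mul_summable.
by congr csum; apply/funext => n; rewrite rmorphM /= conjCK mulrC.
Qed.

Lemma l2_innerPl z a x y :
  l2_inner (a *: x + y) z = a * l2_inner x z + l2_inner y z.
Proof.
rewrite /l2_inner -csumZ; last exact: l2_mul_summable.
rewrite -csumD; first last.
- exact: l2_mul_summable.
- rewrite (_ : (fun n => _) = (fun n => (a *: x) n * conjC (z n))).
    exact: l2_mul_summable.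
  by apply/funext => n; rewrite /= mulrA.
by congr csum; apply/funext => n; rewrite /= mulrDl mulrA.
Qed.

Lemma l2_inner_bilinear : bilinear_for
  (GRing.Scale.Law.clone _ _ *%R _) (GRing.Scale.Law.clone _ _ (conjC \; *%R) _)
  l2_inner.
Proof.
split=> [z|z] a x y /=; first exact: l2_innerPl.
rewrite l2_innerC l2_innerPl rmorphD rmorphM /=.
by rewrite -!l2_innerC.
Qed.

HB.instance Definition _ :=
  bilinear_isBilinear.Build _ _ _ _ _ _ l2_inner l2_inner_bilinear.

Lemma l2_inner_herm x y : l2_inner x y = (-1) ^+ false * conjC (l2_inner y x).
Proof. by rewrite mul1r -l2_innerC. Qed.

HB.instance Definition _ :=
  isHermitianSesquilinear.Build _ _ _ _ l2_inner l2_inner_herm.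

Lemma l2_innerxx x :
  l2_inner x x = (limn (series (fun n => rnorm (x n) ^+ 2)))%:C.
Proof.
rewrite /l2_inner /csum; congr (_ +i* _).
  congr (limn (series _)); apply/funext => n /=.
  by rewrite rnorm_sqE Re_mul Re_conj Im_conj mulrN opprK !expr2.
rewrite (_ : series _ = fun=> 0); first exact: lim_cst.
apply/funext => n; rewrite /series /= big1 // => k _.
by rewrite Im_mul Re_conj Im_conj mulrN mulrC addrC subrr.
Qed.

Lemma l2_partial_le x n :
  \sum_(0 <= k < n) rnorm (x k) ^+ 2 <= limn (series (fun n => rnorm (x n) ^+ 2)).
Proof.
apply: (@nondecreasing_cvgn_le _ (series (fun n => rnorm (x n) ^+ 2))).
  by apply: nondecreasing_series => k _ _; exact: sqr_ge0.
exact: l2_cvg.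
Qed.

Lemma l2_inner_gt0 x : x != 0 -> 0 < l2_inner x x.
Proof.
rewrite l2_innerxx => x0; have [n xn] : exists n, x n != 0.
  apply/not_existsP => xn; move/eqP: x0; apply; apply/val_inj/funext => n /=.
  by have /negP := xn n; rewrite negbK => /eqP.
rewrite ltcR; apply: lt_le_trans (l2_partial_le x n.+1).
rewrite big_nat_recr //= ltr_wpDl //.
  by rewrite sumr_ge0 // => k _; exact: sqr_ge0.
rewrite lt_def sqr_ge0 andbT sqrf_eq0; apply: contra xn => /eqP xn.
by rewrite -normr_eq0 -rnormE xn.
Qed.

HB.instance Definition _ := isDotProduct.Build _ _ l2_inner l2_inner_gt0.

Let l2_dot : {dot (l2 R) for conjC} := l2_inner.

Definition l2_norm x : R[i] := sqrtC (l2_dot x x).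

Lemma l2_normD x y : l2_norm (x + y) <= l2_norm x + l2_norm y.
Proof. exact: dot_triangle. Qed.

Lemma l2_normZ a x : l2_norm (a *: x) = `|a| * l2_norm x.
Proof.
by rewrite /l2_norm dnormZ sqrtCM ?nnegrE ?exprn_ge0 ?dnorm_ge0 // sqrCK.
Qed.

Lemma l2_norm0_eq0 x : l2_norm x = 0 -> x = 0.
Proof. by move=> /eqP; rewrite sqrt_dnorm_eq0 => /eqP. Qed.

HB.instance Definition _ :=
  Lmodule_isNormed.Build R[i] (l2 R) l2_normD l2_normZ l2_norm0_eq0.

End l2_hilbert.

Section l2_complete.
Variable R : realType.
Implicit Types x y : l2 R.

Lemma l2_sqr_normE x : `|x| ^+ 2 = l2_inner x x.
Proof. exact: sqrtCK. Qed.

Lemma l2_rnormE x : rnorm x ^+ 2 = limn (series (fun n => rnorm (x n) ^+ 2)).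
Proof. by apply: complexI; rewrite -l2_innerxx -l2_sqr_normE rmorphXn /= rnormE. Qed.

Lemma rnorm_ge0 (V : normedZmodType R[i]) (v : V) : 0 <= rnorm v.
Proof. by rewrite -lecR rnormE normr_ge0. Qed.

Lemma l2_coord_le x n : rnorm (x n) <= rnorm x.
Proof.
rewrite -(@ler_pXn2r _ 2) ?nnegrE ?rnorm_ge0 // l2_rnormE.
apply: le_trans (l2_partial_le x n.+1).
by rewrite big_nat_recr //= lerDr sumr_ge0 // => k _; exact: sqr_ge0.
Qed.

Lemma l2_of_bounded (a : nat -> R[i]) (M : R) : 0 <= M ->
  (forall n, \sum_(0 <= k < n) rnorm (a k) ^+ 2 <= M ^+ 2) ->
  exists2 x : l2 R, l2seq x = a & rnorm x <= M.
Proof.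
move=> M0 aM.
have nd : nondecreasing_seq (series (fun n => rnorm (a n) ^+ 2)).
  by apply: nondecreasing_series => k _ _; exact: sqr_ge0.
have ca : cvgn (series (fun n => rnorm (a n) ^+ 2)).
  apply: nondecreasing_is_cvgn => //.
  by exists (M ^+ 2) => _ [n _ <-]; exact: aM.
have /square_summableP sa := ca.
exists (L2 sa) => //.
rewrite -(@ler_pXn2r _ 2) ?nnegrE ?rnorm_ge0 // l2_rnormE.
by apply: limr_le => //; near=> n; exact: aM.
Unshelve. all: by end_near. Qed.

Lemma l2_complete (F : set_system (l2 R)) :
  ProperFilter F -> cauchy F -> cvg F.
Proof.
move=> FF /cauchyP Fc.
have Fce (e : R) : 0 < e -> exists x0, F [set x | rnorm (x0 - x) < e].
  move=> e0; have [|x0 Fx0] := Fc e%:C; first by rewrite ltcR.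
  exists x0; apply: filterS Fx0 => x; rewrite -ball_normE /ball_ /=.
  by rewrite -rnormE ltcR.
have cvgF (p : R[i] -> R) : (forall z w : R[i], `|p z - p w| <= rnorm (z - w)) ->
    forall n, exists l : R, (fun x : l2 R => p (x n)) @ F --> l.
  move=> ple n; apply/cvg_ex; apply/cauchy_cvgP/cauchy_exP => e /Fce[x0 Fx0].
  exists (p (x0 n)).
  suff : F [set x | ball (p (x0 n)) e (p (x n))] by [].
  apply: filterS Fx0 => x /= xe; rewrite -ball_normE /ball_ /=.
  by apply: le_lt_trans xe; exact: le_trans (ple _ _) (l2_coord_le (x0 - x) n).
have ReB (z w : R[i]) : `|complex.Re z - complex.Re w| <= rnorm (z - w).
  rewrite -(@ler_pXn2r _ 2) ?nnegrE ?rnorm_ge0 // rnorm_sqE real_normK ?num_real //.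
  by case: z w => [a b] [c d] /=; rewrite lerDl sqr_ge0.
have ImB (z w : R[i]) : `|complex.Im z - complex.Im w| <= rnorm (z - w).
  rewrite -(@ler_pXn2r _ 2) ?nnegrE ?rnorm_ge0 // rnorm_sqE real_normK ?num_real //.
  by case: z w => [a b] [c d] /=; rewrite lerDr sqr_ge0.
have /choice [r Fr] := cvgF _ ReB.
have /choice [i Fi] := cvgF _ ImB.
pose a n := r n +i* i n.
have near_a (e : R) x0 : 0 < e -> F [set x | rnorm (x0 - x) < e] ->
    exists2 y : l2 R, l2seq y = (fun n => x0 n - a n) & rnorm y <= e.
  move=> e0 Fx0; apply: l2_of_bounded (ltW e0) _ => n.
  have : (fun x : l2 R => \sum_(0 <= k < n) rnorm (x0 k - x k) ^+ 2) @ F -->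
      (\sum_(0 <= k < n) rnorm (x0 k - a k) ^+ 2 : R).
    apply: cvg_big => [|k _]; first exact: add_continuous.
    rewrite rnorm_sqE !Re_add !Im_add.
    rewrite (_ : (fun x : l2 R => _) = (fun x : l2 R =>
        (complex.Re (x0 k) - complex.Re (x k)) ^+ 2
      + (complex.Im (x0 k) - complex.Im (x k)) ^+ 2)); last first.
      by apply/funext => x; rewrite rnorm_sqE; case: (x0 k) (x k) => ? ? [].
    apply: cvgD; rewrite !expr2; apply: cvgM; apply: cvgB => //; exact: cvg_cst.
  move=> /cvgr_to_le; apply; apply: filterS Fx0 => x /= /ltW xe.
  apply: le_trans (l2_partial_le (x0 - x) n) _.
  by rewrite -l2_rnormE ler_pXn2r ?nnegrE ?rnorm_ge0 // ltW.
have [x1 Fx1] := Fce 1 ltr01.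
have [y1 y1E _] := near_a 1 x1 ltr01 Fx1.
have aE : l2seq (x1 - y1) = a.
  by apply/funext => n /=; rewrite y1E !fctE opprB addrC subrK.
apply/cvg_ex; exists (x1 - y1); apply/cvgrPdist_le => /= eps eps0.
have epsE : eps = (complex.Re eps)%:C by rewrite RRe_real // gtr0_real.
have e0 : 0 < complex.Re eps / 2 by rewrite divr_gt0 // -ltcR -epsE.
have [x0 Fx0] := Fce _ e0.
have [y yE ye] := near_a _ x0 e0 Fx0.
apply: filterS Fx0 => x /= /ltW xe.
rewrite epsE -rnormE lecR (splitr (complex.Re eps)).
have -> : x1 - y1 - x = (x0 - x) - y.
  apply/val_inj/funext => n; have : x1 n - y1 n = a n by rewrite -aE.
  by rewrite /= !fctE yE => ->; rewrite opprB [RHS]addrC addrA subrK.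
rewrite -lecR rmorphD /= rnormE; apply: le_trans (ler_normB _ _) _.
by rewrite -!rnormE; apply: lerD; rewrite lecR.
Qed.

HB.instance Definition _ := Uniform_isComplete.Build (l2 R) l2_complete.
HB.instance Definition _ :=
  CompleteNormedModule_isHilbert.Build R (l2 R) l2_sqr_normE.

End l2_complete.

Section hilbert_defs.
Variables (R : realType) (H : hilbertType R).
Implicit Types (S L K : set H) (f : nat -> H).

Definition separable := exists2 D : set H, countable D & dense D.

Definition hilbert_subspace L :=
  [/\ L 0, forall (a : R[i]) x y, L x -> L y -> L (a *: x + y) & closed L].

Definition linear_span S : set H :=
  [set x | exists (s : seq H) (c : H -> R[i]),
     (forall v, v \in s -> S v) /\ x = \sum_(v <- s) c v *: v].

Definition closed_span S : set H := closure (linear_span S).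

Definition orthocompl S : set H := [set x | forall y, S y -> inner x y = 0].

Definition linearly_independent f :=
  forall (s : seq nat) (c : nat -> R[i]), uniq s ->
    \sum_(i <- s) c i *: f i = 0 -> forall i, i \in s -> c i = 0.

(* Families indexed by a set D: D := setT for a sequence, b := id for a set. *)
Definition orthonormal_family (I : eqType) (D : set I) (b : I -> H) :=
  forall i j, D i -> D j -> inner (b i) (b j) = (i == j)%:R.

Definition orthonormal_basis L (I : eqType) (D : set I) (b : I -> H) :=
  orthonormal_family D b /\ closed_span (b @` D) = L.

Definition sqr_distance (mu f : nat -> H) : \bar R :=
  (\sum_(0 <= j <oo) (rnorm (mu j - f j) ^+ 2)%:E)%E.

Definition symmetric_orthogonalization f (nu : nat -> H) :=
  [/\ exists2 L, hilbert_subspace L & orthonormal_basis L setT nu,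
      forall mu, orthonormal_family setT mu ->
        (sqr_distance nu f <= sqr_distance mu f)%E
    & (sqr_distance nu f < +oo)%E].

Definition frame K f :=
  (forall i, K (f i)) /\
  exists C D : R, [/\ 0 < C, 0 < D & forall x, K x ->
    ((C * rnorm x ^+ 2)%:E <=
       \sum_(0 <= j <oo) (rnorm (inner x (f j)) ^+ 2)%:E <=
       (D * rnorm x ^+ 2)%:E)%E].

Definition schauder_basis K f :=
  (forall i, K (f i)) /\
  forall x, K x -> exists! c : nat -> R[i],
    series (fun n => c n *: f n) @ \oo --> x.

Definition riesz_basis K f := schauder_basis K f /\ frame K f.

End hilbert_defs.

(* The Hilbert space dimension is the cardinal of an orthonormal basis; all
   orthonormal bases of a given subspace are equipotent. *)
Definition hilbert_dim_le (R : realType) (E H : hilbertType R)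
    (K : set E) (L : set H) :=
  exists (A : set E) (B : set H),
    [/\ orthonormal_basis K A id, orthonormal_basis L B id & (A #<= B)%card].

Section operators.
Variables (R : realType) (E H : hilbertType R).

Definition ker_op (T : E -> H) : set E := [set x | T x = 0].

Definition bounded_operator (T : {linear E -> H}) :=
  bounded_near T (nbhs (0 : E)).

Definition is_adjoint (T : {linear E -> H}) (Ts : {linear H -> E}) :=
  forall x y, inner (T x) y = inner x (Ts y).

(* In the order of R[i], 0 <= z says that z is real and nonnegative. *)
Definition positive_operator (A : {linear E -> E}) :=
  forall x, 0 <= inner (A x) x.

(* A is the positive square root of the operator T^* T. *)
Definition is_abs_operator (T : {linear E -> H}) (A : {linear E -> E}) :=
  [/\ bounded_near A (nbhs (0 : E)), positive_operator A
    & exists2 Ts : {linear H -> E}, is_adjoint T Ts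
        & forall x, A (A x) = Ts (T x)].

Definition initial_space (V : {linear E -> H}) : set E :=
  orthocompl (ker_op V).

Definition partial_isometry (V : {linear E -> H}) :=
  bounded_operator V /\ forall x, initial_space V x -> `|V x| = `|x|.

Definition polar_decomposition (T W : {linear E -> H}) (A : {linear E -> E}) :=
  [/\ is_abs_operator T A, forall x, T x = W (A x), partial_isometry W,
      initial_space W = orthocompl (ker_op T)
    & range W = closure (range T)].

(* The Hilbert-Schmidt norm does not depend on the orthonormal basis. *)
Definition hilbert_schmidt (T : {linear E -> H}) :=
  bounded_operator T /\
  exists2 b : nat -> E, orthonormal_basis setT setT b
    & (\sum_(0 <= n <oo) (rnorm (T (b n)) ^+ 2)%:E < +oo)%E.

End operators.

(* Main.v *)
(* Write A = |F|, N = ker F, and let K = I - A, a self-adjoint Hilbert-Schmidt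
   operator. Since K is Hilbert-Schmidt, N is finite dimensional and F is bounded
   below on the orthogonal complement of N, so that ran F is closed.

   Let U = V + W be an isometry extending W off N, so that F = U A, and let M be
   the isometry sending e_i to mu_i, where (mu_i) is an orthonormal family at
   finite distance from (f_i). With D = M - U, which is Hilbert-Schmidt,
     sum |mu_i - f_i|^2 = |K|_HS^2 + tr (D A D^* ),
   and the trace is nonnegative and vanishes only if D A = 0, i.e. if M = W on
   the orthogonal complement of N. So the minimizers are exactly the maps V + W.

   If some isometry M is at finite Hilbert-Schmidt distance from F, then
   dim N <= dim (ran F)^perp: otherwise a finite rank perturbation G of F would be
   surjective and not injective, and so would be M^* G, which differs from I by a
   Hilbert-Schmidt operator. This contradicts the Fredholm alternative. *)
Require Import Defs.
From HB Require Import structures.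
From mathcomp Require Import all_boot all_order all_algebra sesquilinear.
From mathcomp Require Import complex.
From mathcomp Require Import all_classical all_reals all_analysis.
From mathcomp Require Import ring lra.

Set Implicit Arguments.
Unset Strict Implicit.
Unset Printing Implicit Defensive.
Import Order.TTheory GRing.Theory Num.Theory Num.Def.
Import numFieldNormedType.Exports.
Local Open Scope classical_set_scope.
Local Open Scope ring_scope.

(** The obstacle is that M and U are not Hilbert-Schmidt, so the traces hidden in |M - F|^2 - |U -
    F|^2 diverge one by one: every series that is split or transposed must contain D or K as a
    factor. Transposition rests on one exchange of a nonnegative double sum ([hs_le]), polarized to
    real parts of inner products. As D maps l_2 to H, the trace of D A D^* is summed over a Parseval
    sequence of H, which separability supplies. Compactness is replaced by one fact: a
    Hilbert-Schmidt operator cannot keep the images of an orthonormal sequence at norm at least 1.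
    It yields both the finite dimension of N and the Fredholm alternative. The trace formula
    presupposes U, hence some V, hence the dimension condition. Necessity of that condition
    therefore cannot be read off from the formula, which is why a separate Fredholm argument is
    made. Uniqueness fails for nonzero N through a mere change of sign, since -V is as good as V. *)

Section rnorm_theory.
Variables (R : realType) (V : normedZmodType R[i]).
Implicit Types x y : V.

Lemma ler_rnormD x y : rnorm (x + y) <= rnorm x + rnorm y.
Proof. by rewrite -lecR rmorphD /= !rnormE ler_normD. Qed.

Lemma rnormN x : rnorm (- x) = rnorm x.
Proof. by rewrite /rnorm normrN. Qed.

Lemma rnorm_distC x y : rnorm (x - y) = rnorm (y - x).
Proof. by rewrite /rnorm distrC. Qed.

Lemma rnorm0 : rnorm (0 : V) = 0.
Proof. by rewrite /rnorm normr0. Qed.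

Lemma rnorm_eq0 x : (rnorm x == 0) = (x == 0).
Proof. by rewrite -(inj_eq (@complexI R)) rnormE normr_eq0. Qed.

Lemma rnorm_gt0 x : (0 < rnorm x) = (x != 0).
Proof. by rewrite lt_def rnorm_eq0 rnorm_ge0 andbT. Qed.

Lemma ler_rnormB x y : rnorm (x - y) <= rnorm x + rnorm y.
Proof. by rewrite -(rnormN y); exact: ler_rnormD. Qed.

Lemma ler_rnorm_dist z x y : rnorm (x - y) <= rnorm (x - z) + rnorm (z - y).
Proof. by have := ler_rnormD (x - z) (z - y); rewrite addrA subrK. Qed.

Lemma rnorm_le_eps0 x : (forall eps : R, 0 < eps -> rnorm x < eps) -> x = 0.
Proof.
move=> xe; apply/eqP; rewrite -rnorm_eq0; apply: contraT => x0.
have := xe (rnorm x); rewrite lt_def rnorm_ge0 x0 => /(_ isT).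
by rewrite ltxx.
Qed.

End rnorm_theory.

Lemma rnormM (R : realType) (a b : R[i]) : rnorm (a * b) = rnorm a * rnorm b.
Proof. by apply: complexI; rewrite rmorphM /= !rnormE normrM. Qed.

Lemma rnormZ (R : realType) (V : normedModType R[i]) (a : R[i]) (x : V) :
  rnorm (a *: x) = rnorm a * rnorm x.
Proof. by apply: complexI; rewrite rmorphM /= !rnormE normrZ. Qed.

Lemma rnorm_conj (R : realType) (a : R[i]) : rnorm (conjC a) = rnorm a.
Proof. by rewrite /rnorm norm_conjC. Qed.

Lemma rnormC (R : realType) (a : R) : rnorm (a%:C)%C = `|a|.
Proof.
by apply/eqP; rewrite -(@eqrXn2 _ 2) ?rnorm_ge0 // rnorm_sqE /= expr0n addr0 real_normK ?num_real.
Qed.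

Lemma conjC_real (R : realType) (a : R) : conjC (a%:C)%C = (a%:C)%C.
Proof. exact: conjc_real. Qed.

Lemma rnorm1 (R : realType) : rnorm (1 : R[i]) = 1.
Proof. by rewrite /rnorm normr1. Qed.

Lemma ler_Re_rnorm (R : realType) (a : R[i]) : `|complex.Re a| <= rnorm a.
Proof. by rewrite -lecR rnormE normc_ge_Re. Qed.

(** * Inner products, norms and limits with real epsilons *)

Section inner_theory.
Variables (R : realType) (H : hilbertType R).
Implicit Types (x y z : H) (a : R[i]).

Lemma innerC x y : inner x y = conjC (inner y x).
Proof. by rewrite hermC /= mul1r. Qed.

Lemma innerDl x y z : inner (x + y) z = inner x z + inner y z.
Proof. exact: linearDl. Qed.
Lemma innerDr x y z : inner z (x + y) = inner z x + inner z y.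
Proof. exact: linearDr. Qed.
Lemma innerNl x z : inner (- x) z = - inner x z.
Proof. exact: linearNl. Qed.
Lemma innerNr x z : inner z (- x) = - inner z x.
Proof. exact: linearNr. Qed.
Lemma innerBl x y z : inner (x - y) z = inner x z - inner y z.
Proof. exact: linearBl. Qed.
Lemma innerBr x y z : inner z (x - y) = inner z x - inner z y.
Proof. exact: linearBr. Qed.
Lemma inner0l z : inner 0 z = 0. Proof. exact: linear0l. Qed.
Lemma inner0r z : inner z 0 = 0. Proof. exact: linear0r. Qed.
Lemma innerZl a x z : inner (a *: x) z = a * inner x z.
Proof. exact: linearZl_LR. Qed.
Lemma innerZr a x z : inner z (a *: x) = conjC a * inner z x.
Proof. exact: linearZr_LR. Qed.
Lemma inner_suml (I : Type) (r : seq I) (P : pred I) (F : I -> H) z :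
  inner (\sum_(i <- r | P i) F i) z = \sum_(i <- r | P i) inner (F i) z.
Proof. exact: linear_sumlz. Qed.
Lemma inner_sumr (I : Type) (r : seq I) (P : pred I) (F : I -> H) z :
  inner z (\sum_(i <- r | P i) F i) = \sum_(i <- r | P i) inner z (F i).
Proof. exact: linear_sumr. Qed.

Lemma inner_rnorm x : inner x x = (rnorm x ^+ 2)%:C%C.
Proof. by rewrite rmorphXn /= rnormE sqr_normE. Qed.

Lemma rnorm_Re x : rnorm x ^+ 2 = complex.Re (inner x x).
Proof. by rewrite inner_rnorm. Qed.

Lemma Re_innerC x y : complex.Re (inner x y) = complex.Re (inner y x).
Proof. by rewrite innerC Defs.Re_conj. Qed.

Lemma inner_eq0C x y : inner x y = 0 -> inner y x = 0.
Proof. by move=> xy; rewrite innerC xy conjC0. Qed.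

Lemma cauchy_schwarz x y : rnorm (inner x y) <= rnorm x * rnorm y.
Proof.
rewrite -(@ler_pXn2r _ 2) ?nnegrE ?mulr_ge0 ?rnorm_ge0 //.
rewrite -lecR exprMn.
have -> : (rnorm x ^+ 2 * rnorm y ^+ 2)%:C%C = inner x x * inner y y.
  by rewrite !inner_rnorm rmorphM.
rewrite rmorphXn /= rnormE; exact: dot_cauchy_schwarz.
Qed.

Lemma rnormD_sq x y :
  rnorm (x + y) ^+ 2 = rnorm x ^+ 2 + rnorm y ^+ 2 + 2 * complex.Re (inner x y).
Proof.
rewrite !rnorm_Re innerDl !innerDr !Re_add (Re_innerC y x); ring.
Qed.

Lemma rnormB_sq x y :
  rnorm (x - y) ^+ 2 = rnorm x ^+ 2 + rnorm y ^+ 2 - 2 * complex.Re (inner x y).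
Proof.
by rewrite rnormD_sq rnormN innerNr raddfN /= mulrN.
Qed.

Lemma pythagoras x y : inner x y = 0 ->
  rnorm (x + y) ^+ 2 = rnorm x ^+ 2 + rnorm y ^+ 2.
Proof. by move=> xy; rewrite rnormD_sq xy /= mulr0 addr0. Qed.

Lemma parallelogram x y : rnorm (x + y) ^+ 2 + rnorm (x - y) ^+ 2 =
  2 * (rnorm x ^+ 2 + rnorm y ^+ 2).
Proof. by rewrite rnormD_sq rnormB_sq; ring. Qed.

Lemma inner_inj x y : (forall z, inner x z = inner y z) -> x = y.
Proof.
move=> xy; apply/eqP; rewrite -subr_eq0 -rnorm_eq0 -sqrf_eq0 rnorm_Re.
by rewrite innerBl xy subrr.
Qed.

Lemma inner_self_eq0 x : inner x x = 0 -> x = 0.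
Proof.
by move=> xx; apply/eqP; rewrite -rnorm_eq0 -sqrf_eq0 rnorm_Re xx.
Qed.

Lemma cvg_rnormP (u : nat -> H) x : u @ \oo --> x <->
  forall eps : R, 0 < eps -> exists N, forall n, (N <= n)%N -> rnorm (x - u n) < eps.
Proof.
split=> [ux eps eps0|ux].
  move/cvgrPdist_lt : ux => /(_ (eps%:C)%C); rewrite ltcR => /(_ eps0)[N _ Nu].
  by exists N => n /Nu/=; rewrite -rnormE ltcR.
apply/cvgrPdist_lt => eps eps0.
have epsE : eps = ((complex.Re eps)%:C)%C by rewrite RRe_real // gtr0_real.
have [|N Nu] := ux (complex.Re eps); first by rewrite -ltcR -epsE.
by exists N => // n /= /Nu; rewrite epsE -rnormE ltcR.
Qed.

Lemma cauchy_rnorm_cvg (u : nat -> H) :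
  (forall eps : R, 0 < eps -> exists N, forall m n, (N <= m)%N -> (N <= n)%N ->
     rnorm (u m - u n) < eps) -> exists l : H, u @ \oo --> l.
Proof.
move=> uC; suff : cvg (u @ \oo) by move/cvg_ex.
apply/cauchy_cvgP/cauchy_exP => eps eps0.
have epsE : eps = ((complex.Re eps)%:C)%C by rewrite RRe_real // gtr0_real.
have [|N Nu] := uC (complex.Re eps); first by rewrite -ltcR -epsE.
exists (u N); exists N => // n /= Nn.
by rewrite -ball_normE /ball_ /= epsE -rnormE ltcR; exact: Nu.
Qed.

Lemma closure_rnormP (S : set H) x : closure S x <->
  forall eps : R, 0 < eps -> exists2 y, S y & rnorm (x - y) < eps.
Proof.
split=> [Sx eps eps0|Sx].
  have /Sx[y [Sy yx]] : nbhs x (ball x (eps%:C)%C).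
    by apply: nbhsx_ballx; rewrite ltcR.
  by exists y => //; move: yx; rewrite -ball_normE /ball_ /= -rnormE ltcR.
move=> B /nbhs_ballP[eps/= eps0 epsB].
have epsE : eps = ((complex.Re eps)%:C)%C by rewrite RRe_real // gtr0_real.
have [|y Sy xy] := Sx (complex.Re eps); first by rewrite -ltcR -epsE.
exists y; split => //; apply: epsB.
by rewrite -ball_normE /ball_ /= epsE -rnormE ltcR.
Qed.

Lemma cvg_closure (S : set H) (u : nat -> H) x :
  (forall n, S (u n)) -> u @ \oo --> x -> closure S x.
Proof.
move=> Su /cvg_rnormP ux; apply/closure_rnormP => eps /ux[N Nu].
by exists (u N) => //; exact: Nu.
Qed.

End inner_theory.

Section bounded_operators.
Variables (R : realType) (E H : hilbertType R).

Lemma bounded_rnormP (T : {linear E -> H}) : bounded_operator T <->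
  exists2 M : R, 0 < M & forall x, rnorm (T x) <= M * rnorm x.
Proof.
split=> [/linear_boundedP [M [Mr TM]]|[M M0 TM]].
  exists (`|complex.Re M| + 1); first by rewrite ltr_wpDl.
  move=> x; rewrite -lecR rmorphM /= !rnormE; apply: TM.
  have -> : M = ((complex.Re M)%:C)%C by rewrite RRe_real.
  by rewrite ltcR (le_lt_trans (ler_norm _)) // ltrDl.
apply/linear_boundedP; exists (M%:C)%C; split.
  by apply/complex_realP; exists M.
move=> r Mr x.
rewrite -!rnormE; apply: (@le_trans _ _ (M * rnorm x)%:C%C); first by rewrite lecR.
by rewrite rmorphM /= rnormE ler_wpM2r // ltW.
Qed.

End bounded_operators.

Lemma invS_lt (R : realType) (eps : R) : 0 < eps ->
  exists N, forall n, (N <= n)%N -> n.+1%:R^-1 < eps.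
Proof.
move=> eps0; have [N _ NP] := near_infty_natSinv_lt (PosNum eps0).
by exists N => n; exact: NP.
Qed.

(** * Closed subspaces, closed spans and orthogonal projections *)

Section subspaces.
Variables (R : realType) (H : hilbertType R).
Implicit Types (x y : H) (L S : set H).

Lemma subspace0 L : hilbert_subspace L -> L 0.
Proof. by case. Qed.

Lemma subspaceZ L (a : R[i]) x : hilbert_subspace L -> L x -> L (a *: x).
Proof. by case=> L0 LD _ Lx; rewrite -[_ *: _]addr0; exact: LD. Qed.

Lemma subspaceD L x y : hilbert_subspace L -> L x -> L y -> L (x + y).
Proof. by case=> L0 LD _ Lx Ly; rewrite -[x]scale1r; exact: LD. Qed.

Lemma subspaceB L x y : hilbert_subspace L -> L x -> L y -> L (x - y).
Proof.
by move=> HL Lx Ly; rewrite -scaleN1r; apply: subspaceD => //; exact: subspaceZ.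
Qed.

Lemma subspace_sum L (I : Type) (r : seq I) (P : pred I) (F : I -> H) :
  hilbert_subspace L -> (forall i, P i -> L (F i)) ->
  L (\sum_(i <- r | P i) F i).
Proof.
move=> HL LF; elim/big_ind: _ => //; first exact: subspace0.
by move=> *; exact: subspaceD.
Qed.

Lemma subspace_cvg L (u : nat -> H) x : hilbert_subspace L ->
  (forall n, L (u n)) -> u @ \oo --> x -> L x.
Proof.
by case=> _ _ cL Lu ux; rewrite ((closure_id L).1 cL); exact: cvg_closure ux.
Qed.

Lemma closure_subspace L : L 0 ->
  (forall (a : R[i]) x y, L x -> L y -> L (a *: x + y)) ->
  hilbert_subspace (closure L).
Proof.
move=> L0 LD; split; [exact: subset_closure| |exact: closed_closure].
move=> a x y /closure_rnormP cx /closure_rnormP cy.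
apply/closure_rnormP => eps eps0.
have [|x' Lx' xx'] := cx (eps / 2 / (rnorm a + 1)).
  by rewrite !divr_gt0 // ltr_wpDl // rnorm_ge0.
have [|y' Ly' yy'] := cy (eps / 2); first by rewrite divr_gt0.
exists (a *: x' + y'); first exact: LD.
rewrite opprD addrACA -scalerBr (splitr eps).
apply: le_lt_trans (ler_rnormD _ _) _; apply: ler_ltD => //.
rewrite rnormZ; move/ltW: xx'.
rewrite ler_pdivlMr ?ltr_wpDl ?rnorm_ge0 //; apply: le_trans.
by rewrite mulrC ler_wpM2l ?rnorm_ge0 // lerDl.
Qed.

Lemma linear_span_subset S : S `<=` linear_span S.
Proof.
move=> x Sx; exists [:: x], (fun=> 1); split.
  by move=> v; rewrite inE => /eqP ->.
by rewrite big_seq1 scale1r.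
Qed.

Lemma linear_span_min S L : hilbert_subspace L -> S `<=` L ->
  linear_span S `<=` L.
Proof.
move=> HL SL x [s [c [sS ->]]]; rewrite big_seq.
apply: subspace_sum => // v vs; apply: subspaceZ => //.
exact/SL/sS.
Qed.

(** Coefficients are attached to vectors, not to positions in the list, so two combinations cannot
    simply be concatenated. Both are rewritten over one duplicate-free list, each coefficient being
    multiplied by the number of occurrences of its vector. *)
Lemma linear_spanP S (a : R[i]) x y : linear_span S x -> linear_span S y ->
  linear_span S (a *: x + y).
Proof.
move=> [s [c [sS ->]]] [t [d [tS ->]]].
exists (undup (s ++ t)),
  (fun v => a * (c v *+ count_mem v s) + d v *+ count_mem v t); split.
  by move=> v; rewrite mem_undup mem_cat => /orP[/sS|/tS].
have big_mult (r u : seq H) (k : H -> R[i]) : uniq u -> {subset r <= u} ->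
    \sum_(v <- r) k v *: v = \sum_(v <- u) (k v *+ count_mem v r) *: v.
  move=> uu; elim: r => [_|w r IH wr] /=.
    by rewrite big_nil big1 // => v _; rewrite mulr0n scale0r.
  rewrite big_cons IH; last by move=> v vr; apply: wr; rewrite inE vr orbT.
  under [RHS]eq_bigr do rewrite mulrnDr scalerDl.
  rewrite big_split /=; congr (_ + _).
  rewrite (bigD1_seq w) ?wr ?mem_head //= eqxx mulr1n big1 ?addr0 // => v vw.
  by rewrite eq_sym (negbTE vw) mulr0n scale0r.
rewrite (big_mult s (undup (s ++ t))) ?(big_mult t (undup (s ++ t))) ?undup_uniq //.
- rewrite scaler_sumr -big_split; apply: eq_bigr => v _ /=.
  by rewrite scalerA -scalerDl.
- by move=> v vt; rewrite mem_undup mem_cat vt orbT.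
- by move=> v vs; rewrite mem_undup mem_cat vs.
Qed.

Lemma closed_span_subspace S : hilbert_subspace (closed_span S).
Proof.
apply: closure_subspace; last exact: linear_spanP.
by exists [::], (fun=> 0); split => [v|]; rewrite ?big_nil.
Qed.

Lemma closed_span_subset S : S `<=` closed_span S.
Proof. by move=> x Sx; exact/subset_closure/linear_span_subset. Qed.

Lemma closed_span_min S L : hilbert_subspace L -> S `<=` L ->
  closed_span S `<=` L.
Proof.
move=> HL SL; have [_ _ cL] := HL; rewrite ((closure_id L).1 cL).
by apply: closureS; exact: linear_span_min.
Qed.

Lemma orthocompl_subspace S : hilbert_subspace (orthocompl S).
Proof.
split=> [y _|a x y Sx Sy z Sz|]; first by rewrite inner0l.
  by rewrite innerDl innerZl Sx // Sy // mulr0 addr0.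
move=> x /closure_rnormP cx y Sy; apply: rnorm_le_eps0 => eps eps0.
have [|z Sz xz] := cx (eps / (rnorm y + 1)).
  by rewrite divr_gt0 // ltr_wpDl // rnorm_ge0.
rewrite -[inner x y]subr0 -(Sz _ Sy) -innerBl.
apply: le_lt_trans (cauchy_schwarz _ _) _.
move: xz; rewrite ltr_pdivlMr ?ltr_wpDl ?rnorm_ge0 //; apply: le_lt_trans.
by rewrite ler_wpM2l ?rnorm_ge0 // lerDl.
Qed.

(** Arithmetic core of the projection theorem: [D] is the infimum of the squared distances, [v] its
    value at an approximate minimizer with excess below [i], [cc] stands for |<x - u, y>|^2 and [q]
    for |y|^2. The best move along y lowers the square by [cc * qi], which cannot exceed the
    excess. *)
Lemma quadratic_minimum (K : realFieldType) (D i v cc q qi : K) :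
  v < D + i -> qi * q = 1 ->
  D <= v + qi ^+ 2 * cc * q - 2 * (qi * cc) -> cc * qi <= i.
Proof.
move=> vD q1; have -> : qi ^+ 2 * cc * q = cc * qi * (qi * q) by ring.
by rewrite q1; lra.
Qed.

Lemma projection_exists L x : hilbert_subspace L ->
  exists2 p, L p & orthocompl L (x - p).
Proof.
move=> HL; pose D := inf [set rnorm (x - y) ^+ 2 | y in L].
have Dlb : lbound [set rnorm (x - y) ^+ 2 | y in L] 0.
  by move=> _ [y _ <-]; exact: sqr_ge0.
have Dle y : L y -> D <= rnorm (x - y) ^+ 2.
  by move=> Ly; apply: ge_inf; [exists 0|exists y].
have hasD : has_inf [set rnorm (x - y) ^+ 2 | y in L].
  by split; [exists (rnorm (x - 0) ^+ 2); exists 0 => //; exact: subspace0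
            |exists 0].
have /choice[u uP] : forall n, exists y, L y /\ rnorm (x - y) ^+ 2 < D + n.+1%:R^-1.
  move=> n; have n0 : 0 < n.+1%:R^-1 :> R by rewrite invr_gt0.
  by have [_ [y Ly <-] yD] := inf_adherent n0 hasD; exists y.
have uL n : L (u n) by have [] := uP n.
have uC : forall eps : R, 0 < eps -> exists N, forall m n, (N <= m)%N ->
    (N <= n)%N -> rnorm (u m - u n) < eps.
  (* The parallelogram law, with [D] bounding the midpoint from below, gives |u_m - u_n|^2 < 2
     (1/(m+1) + 1/(n+1)); hence the quarter of eps^2. *)
  move=> eps eps0; have [|N Nlt] := @invS_lt R (eps ^+ 2 / 4).
    by rewrite divr_gt0 // exprn_gt0.
  exists N => m n /Nlt mlt /Nlt nlt.
  rewrite -(@ltr_pXn2r _ 2) ?nnegrE ?rnorm_ge0 ?ltW //.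
  have := parallelogram (x - u m) (x - u n).
  have -> : x - u m - (x - u n) = u n - u m.
    by rewrite opprB addrC addrA subrK addrC.
  rewrite (rnorm_distC (u n)).
  have -> : x - u m + (x - u n) = 2 *: (x - 2^-1 *: (u m + u n)).
    rewrite scalerBr scalerA mulfV ?pnatr_eq0 // scale1r scaler_nat mulr2n.
    by rewrite opprD addrACA.
  rewrite rnormZ exprMn (_ : rnorm 2 = 2 :> R); last by rewrite /rnorm normr_nat.
  have : D <= rnorm (x - 2^-1 *: (u m + u n)) ^+ 2.
    by apply: Dle; apply: subspaceZ => //; exact: subspaceD.
  have [_ um] := uP m; have [_ un] := uP n.
  move: mlt nlt um un; move: (m.+1%:R^-1) (n.+1%:R^-1) => a b.
  by rewrite -natrX; lra.
have [p up] := cauchy_rnorm_cvg uC.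
exists p; first exact: subspace_cvg up.
move=> y Ly; apply: rnorm_le_eps0 => eps eps0.
pose eta := eps / 2 / (rnorm y + 1).
have y1 : 0 < rnorm y + 1 by rewrite ltr_wpDl // rnorm_ge0.
have eta0 : 0 < eta by rewrite !divr_gt0.
have etay : eta * rnorm y < eps / 2.
  rewrite /eta mulrAC ltr_pdivrMr // ltr_pM2l ?divr_gt0 //.
  by rewrite ltrDl.
move/cvg_rnormP : up => /(_ _ eta0)[N1 N1P].
have [|N2 N2P] := @invS_lt R (eta ^+ 2); first by rewrite exprn_gt0.
pose n := maxn N1 N2; have pn := N1P n (leq_maxl _ _).
have nlt := N2P n (leq_maxr _ _).
(* Near-minimality controls x - u_n, not x - p, so orthogonality is estimated at u_n and the error p
   - u_n is treated by Cauchy-Schwarz; [eta] makes each part at most eps/2. *)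
have -> : inner (x - p) y = inner (x - u n) y - inner (p - u n) y.
  by rewrite -innerBl opprB addrA subrK.
apply: le_lt_trans (ler_rnormB _ _) _; rewrite (splitr eps); apply: ler_ltD.
  apply: le_trans (ltW etay).
  rewrite -(@ler_pXn2r _ 2) ?nnegrE ?rnorm_ge0 ?(mulr_ge0 (ltW eta0) (rnorm_ge0 _)) //.
  have [->|y0] := eqVneq y 0; first by rewrite inner0r !rnorm0 mulr0 !expr0n.
  set c := inner (x - u n) y.
  have q0 : 0 < rnorm y ^+ 2 by rewrite exprn_gt0 // rnorm_gt0.
  have q1 : (rnorm y ^+ 2)^-1 * rnorm y ^+ 2 = 1 by rewrite mulVf ?gt_eqF.
  (* The infimum is tested at the best approximation of x on the line through u_n in direction y. *)
  have := Dle (u n + (((rnorm y ^+ 2)^-1)%:C%C * c) *: y).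
  move=> /(_ (subspaceD HL (uL n) (subspaceZ _ HL Ly))).
  have Ret : complex.Re (conjC (((rnorm y ^+ 2)^-1)%:C%C * c) * c) =
      (rnorm y ^+ 2)^-1 * rnorm c ^+ 2.
    by rewrite Re_mul Defs.Re_conj Defs.Im_conj Re_mul Im_mul /= rnorm_sqE; ring.
  rewrite opprD addrA rnormB_sq innerZr -/c Ret rnormZ rnormM rnormC.
  rewrite ger0_norm ?invr_ge0 ?(ltW q0) // 2!exprMn [(eta * _) ^+ 2]exprMn.

  have [_ un] := uP n; move: un nlt q1 q0.
  move: (n.+1%:R^-1) (eta ^+ 2) (rnorm (x - u n) ^+ 2) (rnorm c ^+ 2) => i e v cc.
  move: (rnorm y ^+ 2) => q un nlt q1 q0 /(quadratic_minimum un q1).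
  move=> cq; apply: (@le_trans _ _ (i * q)).
    by rewrite -[leLHS](mulr1 cc) -q1 mulrA ler_pM2r.
  by rewrite ler_pM2r // ltW.
by apply: le_lt_trans etay; apply: le_trans (cauchy_schwarz _ _) _;
  rewrite ler_wpM2r ?rnorm_ge0 // ltW.
Qed.

End subspaces.

(** * Orthogonal complements and the Riesz representation theorem *)

Section orthogonality.
Variables (R : realType) (H : hilbertType R).
Implicit Types (x y : H) (L S : set H).

Lemma orthocompl_inner S x y : S x -> orthocompl S y -> inner x y = 0.
Proof. by move=> Sx /(_ _ Sx)/inner_eq0C. Qed.

Lemma orthocompl_closed_span S x : (forall y, S y -> inner x y = 0) ->
  orthocompl (closed_span S) x.
Proof.
move=> xS y /(closed_span_min (orthocompl_subspace [set x])) yx.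
by apply/inner_eq0C/yx => // z Sz _ ->; exact/inner_eq0C/xS.
Qed.

Lemma subspace_split L x : hilbert_subspace L ->
  exists p q, [/\ L p, orthocompl L q & x = p + q].
Proof.
move=> HL; have [p Lp Lxp] := projection_exists x HL.
by exists p, (x - p); split => //; rewrite addrC subrK.
Qed.

Lemma orthocomplK L : hilbert_subspace L -> orthocompl (orthocompl L) = L.
Proof.
move=> HL; apply/seteqP; split=> x; last first.
  by move=> Lx y Ly; exact: orthocompl_inner Ly.
have [p [q [Lp Lq ->]]] := subspace_split x HL => /(_ q Lq).
rewrite innerDl (orthocompl_inner Lp Lq) add0r => /inner_self_eq0 ->.
by rewrite addr0.
Qed.

Lemma orthocompl_disjoint L x : L x -> orthocompl L x -> x = 0.
Proof. by move=> Lx Lcx; apply: inner_self_eq0; exact: Lcx. Qed.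

Lemma riesz_representation (phi : H -> R[i]) (M : R) :
  (forall (a : R[i]) x y, phi (a *: x + y) = a * phi x + phi y) ->
  (forall x, rnorm (phi x) <= M * rnorm x) ->
  exists v, forall x, phi x = inner x v.
Proof.
move=> phiP phiM.
have phi0 : phi 0 = 0.
  have := phiP 1 0 0; rewrite scale1r addr0 mul1r => /eqP.
  by rewrite -subr_eq subrr eq_sym => /eqP.
have phiZ a x : phi (a *: x) = a * phi x.
  by rewrite -[a *: x]addr0 phiP phi0 addr0.
have phiB x y : phi (x - y) = phi x - phi y.
  by rewrite addrC -scaleN1r phiP mulN1r addrC.
pose L := [set x | phi x = 0].
have HL : hilbert_subspace L.
  split=> // [a x y Lx Ly|]; first by rewrite /L /= phiP Lx Ly mulr0 addr0.
  move=> x /closure_rnormP cx; apply: rnorm_le_eps0 => eps eps0.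
  have [|y Ly xy] := cx (eps / (`|M| + 1)).
    by rewrite divr_gt0 // ltr_wpDl.
  rewrite -[phi x]subr0 -Ly -phiB; apply: le_lt_trans (phiM _) _.
  move: xy; rewrite ltr_pdivlMr ?ltr_wpDl //; apply: le_lt_trans.
  by rewrite mulrC ler_wpM2l ?rnorm_ge0 // (le_trans (ler_norm _)) // lerDl.
have [[x0 x0P]|nx] := pselect (exists x, phi x <> 0); last first.
  exists 0 => x; rewrite inner0r; apply: contrapT => px.
  by apply: nx; exists x.
have [p [w [Lp Lw x0E]]] := subspace_split x0 HL.
have pw : phi w <> 0.
  by rewrite (_ : w = x0 - p) ?phiB ?Lp ?subr0 // x0E addrC addKr.
have ww : inner w w != 0.
  by apply/eqP => /inner_self_eq0 w0; apply: pw; rewrite w0 phi0.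
exists (conjC (phi w / inner w w) *: w) => x.
rewrite innerZr conjCK.
have : inner (x - (phi x / phi w) *: w) w = 0.
  apply: (orthocompl_inner _ Lw).
  by rewrite /L /= phiB phiZ divfK ?subrr //; exact/eqP.
rewrite innerBl innerZl => /eqP; rewrite subr_eq0 => /eqP ->.
by field; rewrite ww andbT; exact/eqP.
Qed.

End orthogonality.

(** * Adjoints and isometries *)

Section adjoint.
Variables (R : realType) (E H : hilbertType R).

Lemma linear_of_fun (g : H -> E) :
  (forall (a : R[i]) x y, g (a *: x + y) = a *: g x + g y) ->
  exists T : {linear H -> E}, forall x, T x = g x.
Proof.
move=> gP; pose m := GRing.isLinear.Build R[i] H E *:%R g gP.
pose T : {linear H -> E} := HB.pack g m.
by exists T.
Qed.

Lemma adjoint_exists (T : {linear E -> H}) : bounded_operator T ->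
  exists Ts : {linear H -> E}, is_adjoint T Ts.
Proof.
move=> /bounded_rnormP[M M0 TM].
have /choice[g gP] : forall y, exists v, forall x, inner (T x) y = inner x v.
  move=> y; apply: (@riesz_representation _ _ _ (M * rnorm y)).
    by move=> a x z; rewrite linearP innerDl innerZl.
  move=> x; apply: le_trans (cauchy_schwarz _ _) _.
  by rewrite mulrAC ler_wpM2r ?rnorm_ge0.
have [|Ts TsE] := @linear_of_fun g.
  move=> a x y; apply: inner_inj => z; rewrite innerC -gP innerDl innerDr innerZl innerZr.
  by rewrite rmorphD rmorphM /= conjCK !gP -!innerC.
by exists Ts => x y; rewrite TsE gP.
Qed.

Lemma adjoint_bounded (T : E -> H) (Ts : H -> E) (M : R) :
  0 <= M -> (forall x y, inner (T x) y = inner x (Ts y)) ->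
  (forall x, rnorm (T x) <= M * rnorm x) ->
  forall y, rnorm (Ts y) <= M * rnorm y.
Proof.
move=> M0 TTs TM y; have [->|y0] := eqVneq (Ts y) 0.
  by rewrite rnorm0 mulr_ge0 ?rnorm_ge0.
have y1 : 0 < rnorm (Ts y) by rewrite rnorm_gt0.
rewrite -(ler_pM2r y1) -expr2 rnorm_Re -TTs.
apply: le_trans (ler_norm _) _; apply: le_trans (ler_Re_rnorm _) _.
apply: le_trans (cauchy_schwarz _ _) _.
by rewrite mulrAC ler_wpM2r ?rnorm_ge0.
Qed.

Lemma isometry_inner (T : {linear E -> H}) (L : set E) : hilbert_subspace L ->
  (forall x, L x -> rnorm (T x) = rnorm x) ->
  forall x y, L x -> L y -> inner (T x) (T y) = inner x y.
Proof.
move=> HL TL.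
have ReT x y : L x -> L y -> complex.Re (inner (T x) (T y)) = complex.Re (inner x y).
  move=> Lx Ly; have := TL _ (subspaceD HL Lx Ly).
  move=> /(congr1 (fun t => t ^+ 2)); rewrite linearD !rnormD_sq !TL //.
  by move=> /addrI /mulfI; apply; rewrite pnatr_eq0.
move=> x y Lx Ly; apply/eqP; rewrite eq_complex ReT // eqxx /=.
(* Replacing y by iy turns the imaginary part of the inner product into a real part. *)
have := ReT x ('i%C *: y) Lx (subspaceZ _ HL Ly).
rewrite linearZ /= !innerZr !Re_mul Defs.Re_conj Defs.Im_conj /=.
by rewrite !mul0r !sub0r !mulN1r !opprK => ->.
Qed.

End adjoint.

(** * Nonnegative series, real and extended *)

Section nneseries_real.
Variable R : realType.
Implicit Types u : nat -> R.

Lemma nneseries_cvgE u (l : R) : series u @ \oo --> l ->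
  (\sum_(0 <= k <oo) (u k)%:E)%E = l%:E.
Proof.
move=> ul; apply/cvg_lim => //.
rewrite (_ : (fun n => _) = EFin \o series u); last first.
  by apply/funext => n; rewrite /series /= sumEFin.
by apply: cvg_EFin => //; exact: nearW.
Qed.

Lemma nneseries_le u (l : \bar R) :
  (forall k, 0 <= u k) ->
  (forall n, ((\sum_(0 <= k < n) u k)%:E <= l)%E) ->
  (\sum_(0 <= k <oo) (u k)%:E <= l)%E.
Proof.
move=> u0 ul; apply: lime_le.
  by apply: is_cvg_nneseries => k _ _; rewrite lee_fin.
by near=> n; rewrite sumEFin.
Unshelve. all: by end_near. Qed.

Lemma nneseries_cvg u : (forall k, 0 <= u k) ->
  (\sum_(0 <= k <oo) (u k)%:E < +oo)%E -> cvgn (series u).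
Proof. exact: nnseries_is_cvg. Qed.

Lemma nneseries_lt u v : (forall k, 0 <= u k <= v k) ->
  (\sum_(0 <= k <oo) (v k)%:E < +oo)%E -> (\sum_(0 <= k <oo) (u k)%:E < +oo)%E.
Proof.
move=> uv; apply: le_lt_trans; apply: lee_nneseries => k _.
  by rewrite lee_fin; have /andP[] := uv k.
by rewrite lee_fin; have /andP[] := uv k.
Qed.

End nneseries_real.

(** * Orthogonal series, Bessel and Parseval *)

Section orthogonal_series.
Variables (R : realType) (H : hilbertType R).
Implicit Types (x y : H) (v b : nat -> H).

(** The coefficients of the partial sums of an orthogonal expansion are eventually constant, so an
    eventual equality can stand in for a limit of scalars. *)
Lemma inner_cvg v (l y : H) (c : R[i]) : v @ \oo --> l ->
  (exists N, forall n, (N <= n)%N -> inner (v n) y = c) -> inner l y = c.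
Proof.
move=> /cvg_rnormP vl [N vc]; apply/eqP; rewrite -subr_eq0; apply/eqP.
apply: rnorm_le_eps0 => eps eps0.
have y1 : 0 < rnorm y + 1 by rewrite ltr_wpDl // rnorm_ge0.
have [|N' vN] := vl (eps / (rnorm y + 1)); first by rewrite divr_gt0.
rewrite -(vc (maxn N N')) ?leq_maxl // -innerBl.
apply: le_lt_trans (cauchy_schwarz _ _) _.
have := vN _ (leq_maxr N N').
rewrite ltr_pdivlMr //; apply: le_lt_trans.
by rewrite ler_wpM2l ?rnorm_ge0 // lerDl.
Qed.

Lemma rnorm_cvg v (l : H) : v @ \oo --> l -> (fun n => rnorm (v n)) @ \oo --> rnorm l.
Proof.
move=> /cvg_rnormP vl; apply/cvgrPdist_lt => eps eps0.
have [N vN] := vl _ eps0; exists N => // n /= /vN; apply: le_lt_trans.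
rewrite ler_norml; have := ler_rnormD (v n) (l - v n).
have := ler_rnormB l (l - v n); rewrite opprB (addrC l) subrK (addrC (v n)) subrK => h1 h2.
by apply/andP; split; lra.
Qed.

Lemma pythagoras_sum v m n : (forall i j, i != j -> inner (v i) (v j) = 0) ->
  rnorm (\sum_(m <= k < n) v k) ^+ 2 = \sum_(m <= k < n) rnorm (v k) ^+ 2.
Proof.
move=> vo; have [nm|mn] := leqP n m.
  by rewrite !big_geq // rnorm0 expr0n.
rewrite -(subnKC (ltnW mn)); elim: (n - m)%N => [|k IH].
  by rewrite addn0 !big_geq // rnorm0 expr0n.
rewrite addnS !big_nat_recr ?leq_addr //= pythagoras ?IH //.
rewrite inner_suml big_nat big1 // => i /andP[_ ik]; apply: vo.
by rewrite neq_ltn ik.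
Qed.

Lemma orthogonal_series_cvg v : (forall i j, i != j -> inner (v i) (v j) = 0) ->
  cvgn (series (fun k => rnorm (v k) ^+ 2)) -> exists l : H, series v @ \oo --> l.
Proof.
move=> vo /cvg_ex[s /cvgrPdist_lt vs]; apply: cauchy_rnorm_cvg => eps eps0.
have [|N _ vN] := vs (eps ^+ 2 / 2); first by rewrite divr_gt0 // exprn_gt0.
exists N; suff wl m n : (N <= m)%N -> (m <= n)%N -> rnorm (series v n - series v m) < eps.
  move=> m n Nm Nn; have [mn|/ltnW nm] := leqP m n; last exact: wl.
  by rewrite rnorm_distC; exact: wl.
move=> Nm mn; rewrite -(@ltr_pXn2r _ 2) ?nnegrE ?rnorm_ge0 ?ltW //.
rewrite sub_series_geq // pythagoras_sum // -sub_series_geq //.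
have := vN m Nm; have := vN n (leq_trans Nm mn).
rewrite /= !ltr_norml => /andP[? ?] /andP[? ?]; lra.
Qed.

(* Every member is zero or a unit vector: Gram-Schmidt then needs no selection
   of independent vectors. *)
Definition suborthonormal b :=
  forall i j, inner (b i) (b j) = ((i == j) && (b i != 0))%:R.

Lemma orthonormal_suborthonormal b :
  orthonormal_family setT b -> suborthonormal b.
Proof.
move=> bo i j; rewrite bo //; case: eqVneq => //= _.
suff -> : b i != 0 by [].
apply/eqP => bi; have := bo i i I I; rewrite bi inner0l eqxx => /eqP.
by rewrite eq_sym oner_eq0.
Qed.

Lemma suborthonormal_orth b i j : suborthonormal b -> i != j -> inner (b i) (b j) = 0.
Proof. by move=> bo /negbTE ij; rewrite bo ij. Qed.

Lemma suborthonormal_norm b i : suborthonormal b -> rnorm (b i) = (b i != 0)%:R.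
Proof.
move=> bo; apply/eqP; rewrite -(@eqrXn2 _ 2) ?rnorm_ge0 ?ler0n // rnorm_Re bo eqxx /=.
by case: (b i != 0); rewrite /= ?expr1n ?expr0n.
Qed.

Lemma suborthonormal_coef b x i : suborthonormal b ->
  rnorm (inner x (b i) *: b i) = rnorm (inner x (b i)).
Proof.
move=> bo; rewrite rnormZ suborthonormal_norm //.
by case: eqP => [->|]; rewrite ?inner0r ?rnorm0 ?mul0r ?mulr1.
Qed.

Lemma suborthonormal_series_orth b (c : nat -> R[i]) : suborthonormal b ->
  forall i j, i != j -> inner (c i *: b i) (c j *: b j) = 0.
Proof.
by move=> bo i j ij; rewrite innerZl innerZr suborthonormal_orth // !mulr0.
Qed.

Lemma suborthonormal_partial b (c : nat -> R[i]) j n : suborthonormal b ->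
  (j < n)%N -> inner (series (fun k => c k *: b k) n) (b j) = c j * (b j != 0)%:R.
Proof.
move=> bo jn; rewrite /series /= inner_suml (bigD1_seq j) ?mem_index_iota ?iota_uniq //=.
rewrite innerZl bo eqxx /= big1 ?addr0 // => i ij.
by rewrite innerZl suborthonormal_orth // mulr0.
Qed.

Lemma suborthonormal_coef0 b x j : suborthonormal b ->
  inner x (b j) * (b j != 0)%:R = inner x (b j).
Proof.
by move=> bo; case: eqP => [->|]; rewrite ?inner0r ?mul0r ?mulr1.
Qed.

Lemma bessel_partial b x n : suborthonormal b ->
  \sum_(0 <= k < n) rnorm (inner x (b k)) ^+ 2 <= rnorm x ^+ 2.
Proof.
move=> bo; pose s := series (fun k => inner x (b k) *: b k) n.
have sE : rnorm s ^+ 2 = \sum_(0 <= k < n) rnorm (inner x (b k)) ^+ 2.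
  rewrite pythagoras_sum; last exact: suborthonormal_series_orth.
  by apply: eq_bigr => k _; rewrite suborthonormal_coef.
rewrite -sE -[in leRHS](subrK s x) pythagoras ?lerDr ?sqr_ge0 //.
rewrite {2}/s /series /= inner_sumr big_nat big1 // => k /andP[_ kn].
rewrite innerZr innerBl suborthonormal_partial // suborthonormal_coef0 //.
by rewrite subrr mulr0.
Qed.

Definition bessel_family b := forall x,
  (\sum_(0 <= k <oo) (rnorm (inner x (b k)) ^+ 2)%:E <= (rnorm x ^+ 2)%:E)%E.

(** The one property of a basis that the trace computations use. Zero members are allowed, so the
    output of Gram-Schmidt qualifies as it is. *)
Definition parseval_family b := forall x,
  (\sum_(0 <= k <oo) (rnorm (inner x (b k)) ^+ 2)%:E = (rnorm x ^+ 2)%:E)%E.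

Lemma suborthonormal_bessel b : suborthonormal b -> bessel_family b.
Proof.
move=> bo x; apply: nneseries_le => [k|n]; first exact: sqr_ge0.
by rewrite lee_fin; exact: bessel_partial.
Qed.

Lemma parseval_bessel b : parseval_family b -> bessel_family b.
Proof. by move=> bp x; rewrite bp. Qed.

Lemma bessel_cvg b x : bessel_family b ->
  cvgn (series (fun k => rnorm (inner x (b k)) ^+ 2)).
Proof.
move=> bb; apply: nneseries_cvg => [k|]; first exact: sqr_ge0.
by apply: le_lt_trans (bb x) _; rewrite ltry.
Qed.

Lemma suborthonormal_expansion b x : suborthonormal b ->
  closed_span (range b) x ->
  series (fun k => inner x (b k) *: b k) @ \oo --> x.
Proof.
move=> bo bx.
have [|l vl] := orthogonal_series_cvg (suborthonormal_series_orth (fun k => inner x (b k)) bo).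
  rewrite (_ : (fun k => _) = fun k => rnorm (inner x (b k)) ^+ 2).
    exact/bessel_cvg/suborthonormal_bessel.
  by apply/funext => k; rewrite suborthonormal_coef.
suff lx : l = x by rewrite -[X in _ --> X]lx.
have HL := closed_span_subspace (range b).
apply/eqP; rewrite -subr_eq0; apply/eqP.
apply: (@orthocompl_disjoint _ _ (closed_span (range b))).
  apply: (subspaceB HL) => //; apply: (subspace_cvg HL _ vl) => n.
  apply: (subspace_sum _ HL) => // k _; apply: (subspaceZ _ HL).
  by apply: closed_span_subset; exists k.
apply: orthocompl_closed_span => _ [j _ <-].
rewrite innerBl (inner_cvg (c := inner x (b j)) vl) ?subrr //.
exists j.+1 => n jn.
by rewrite (suborthonormal_partial (fun k => inner x (b k))) // suborthonormal_coef0.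
Qed.

Lemma suborthonormal_parseval b : suborthonormal b ->
  closed_span (range b) = setT -> parseval_family b.
Proof.
move=> bo bT x; apply: nneseries_cvgE.
have : closed_span (range b) x by rewrite bT.
move=> /(suborthonormal_expansion bo)/rnorm_cvg xl.
rewrite (_ : series _ =
    (fun n => rnorm (series (fun k => inner x (b k) *: b k) n) ^+ 2)).
  by rewrite expr2; under eq_fun do rewrite expr2; exact: cvgM.
apply/funext => n; rewrite pythagoras_sum; last exact: suborthonormal_series_orth.
by apply: eq_bigr => k _; rewrite suborthonormal_coef.
Qed.

Lemma orthonormal_basis_parseval b :
  orthonormal_basis setT setT b -> parseval_family b.
Proof.
by move=> [/orthonormal_suborthonormal bo bT]; exact: suborthonormal_parseval.
Qed.

End orthogonal_series.

(** * Isometries prescribed on an orthonormal basis *)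

Section isometry_of_families.
Variables (R : realType) (E H : hilbertType R).

(** This turns the competing orthonormal sequences into operators: [M x] is the sum of <x, e_k>
    nu_k, which converges by Bessel and preserves norms by Pythagoras on partial sums. *)
Lemma isometry_exists (e : nat -> E) (nu : nat -> H) :
  orthonormal_basis setT setT e -> orthonormal_family setT nu ->
  exists M : {linear E -> H},
    (forall i, M (e i) = nu i) /\ forall x, rnorm (M x) = rnorm x.
Proof.
move=> eb nuo; have eo := orthonormal_suborthonormal eb.1.
have nus := orthonormal_suborthonormal nuo.
have nu0 k : nu k != 0.
  apply/eqP => k0; have := nuo k k I I.
  by rewrite k0 inner0l eqxx => /eqP; rewrite eq_sym oner_eq0.
have nunorm k : rnorm (nu k) = 1 by rewrite suborthonormal_norm // nu0.
have coefE x k : rnorm (inner x (e k) *: nu k) = rnorm (inner x (e k)).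
  by rewrite rnormZ nunorm mulr1.
have /choice[g gP] : forall x, exists y : H,
    series (fun k => inner x (e k) *: nu k) @ \oo --> y.
  move=> x; apply: orthogonal_series_cvg; first exact: suborthonormal_series_orth.
  under eq_fun do rewrite coefE.
  exact/bessel_cvg/suborthonormal_bessel.
have [|M ME] := @linear_of_fun _ H E g.
  move=> a x y; apply: (cvg_unique _ (gP _)); first exact: norm_hausdorff.
  rewrite (_ : series _ = a *: series (fun k => inner x (e k) *: nu k) +
      series (fun k => inner y (e k) *: nu k)).
    by apply: cvgD; [apply: cvgZr|]; exact: gP.
  apply/funext => n; rewrite /series /= !fctE scaler_sumr -big_split.
  by apply: eq_bigr => k _; rewrite innerDl innerZl scalerDl scalerA.
exists M; split=> [i|x].
  rewrite ME; apply: (cvg_unique _ (gP _)); first exact: norm_hausdorff.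
  apply/cvg_rnormP => eps eps0; exists i.+1 => n ni.
  rewrite /series /= (bigD1_seq i) ?mem_index_iota ?iota_uniq //=.
  rewrite eb.1 // eqxx scale1r big1 ?addr0 ?subrr ?rnorm0 // => j ji.
  by rewrite eb.1 // eq_sym (negbTE ji) scale0r.
have ex : closed_span (range e) x by rewrite eb.2.
rewrite ME; apply: (cvg_unique _ (rnorm_cvg (gP x))); first exact: norm_hausdorff.
suff -> : (fun n => rnorm (series (fun k => inner x (e k) *: nu k) n)) =
    (fun n => rnorm (series (fun k => inner x (e k) *: e k) n)).
  exact/rnorm_cvg/suborthonormal_expansion.
apply/funext => n; apply/eqP; rewrite -(@eqrXn2 _ 2) ?rnorm_ge0 //.
rewrite !pythagoras_sum; do ?exact: suborthonormal_series_orth.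
by apply/eqP/eq_bigr => k _; rewrite coefE suborthonormal_coef.
Qed.

End isometry_of_families.

(** * Gram-Schmidt and bases of closed subspaces *)

Section gram_schmidt.
Variables (R : realType) (H : hilbertType R).
Implicit Types (x y : H) (L S : set H) (d h : nat -> H).

Lemma closed_spanS S S' : S `<=` S' -> closed_span S `<=` closed_span S'.
Proof.
move=> SS'; apply: closed_span_min; first exact: closed_span_subspace.
by apply: subset_trans SS' _; exact: closed_span_subset.
Qed.

Lemma normalizeE (w : H) : w != 0 ->
  inner (((rnorm w)^-1)%:C%C *: w) (((rnorm w)^-1)%:C%C *: w) = 1.
Proof.
move=> w0; rewrite innerZl innerZr conjC_real inner_rnorm -!rmorphM /=.
by rewrite mulrA -expr2 exprVn mulVf ?rmorph1 // sqrf_eq0 rnorm_eq0.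
Qed.

Lemma gram_schmidt d : exists2 h, suborthonormal h &
  closed_span (range h) = closed_span (range d).
Proof.
pose L n := closed_span (d @` `I_n).
have HL n : hilbert_subspace (L n) by exact: closed_span_subspace.
have LS m n : (m <= n)%N -> L m `<=` L n.
  by move=> mn; apply: closed_spanS => _ [i /= im <-]; exists i => //=; exact: leq_trans mn.
have /choice[w wP] : forall n, exists w, L n (d n - w) /\ orthocompl (L n) w.
  move=> n; have [p [q [Lp Lq dE]]] := subspace_split (d n) (HL n).
  by exists q; split => //; rewrite dE addrK.
(* The inverse of 0 being 0, [h n] vanishes together with [w n], that is when [d n] already lies in
   the span of its predecessors. *)
pose h n := ((rnorm (w n))^-1)%:C%C *: w n.
have hL n : L n.+1 (h n).
  apply: (subspaceZ _ (HL n.+1)); rewrite -(opprK (w n)) -[- w n](addKr (d n)).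
  rewrite opprD opprK; apply: (subspaceB (HL n.+1)).
    by apply: closed_span_subset; exists n => /=.
  by apply: (LS n) => //; have [] := wP n.
have hLc n : orthocompl (L n) (h n).
  by apply: (subspaceZ _ (orthocompl_subspace (L n))); have [] := wP n.
have h_orth i j : (i < j)%N -> inner (h j) (h i) = 0.
  by move=> ij; apply: hLc; exact: LS (hL i).
exists h.
  move=> i j; have [ij|ji|<-] := ltngtP i j.
  - by rewrite (inner_eq0C (h_orth _ _ ij)).
  - by rewrite h_orth.
  - have [wi|wi] := eqVneq (w i) 0.
      by rewrite /h wi scaler0 inner0l eqxx.
    have hh := normalizeE wi; rewrite hh; case: eqP => // hi.
    by move: hh; rewrite -/(h i) hi inner0l => /esym.
apply/seteqP; split.
  apply: closed_span_min; first exact: closed_span_subspace.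
  move=> _ [n _ <-]; apply: closed_spanS (hL n).
  by move=> _ [i _ <-]; exists i.
apply: closed_span_min; first exact: closed_span_subspace.
have Hh := closed_span_subspace (range h).
suff dh n : forall m, (m < n)%N -> closed_span (range h) (d m).
  by move=> _ [m _ <-]; exact: (dh m.+1).
elim: n => // n IH m; rewrite ltnS leq_eqVlt => /orP[/eqP ->|]; last exact: IH.
rewrite -(subrK (w n) (d n)); apply: (subspaceD Hh).
  apply: (closed_span_min Hh) (wP n).1 => _ [i /= ilt <-]; exact: IH.
have [->|wn] := eqVneq (w n) 0; first exact: subspace0.
have -> : w n = (rnorm (w n))%:C%C *: h n.
  by rewrite /h scalerA -rmorphM mulfV ?rnorm_eq0 // rmorph1 scale1r.
by apply: (subspaceZ _ Hh); apply: closed_span_subset; exists n.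
Qed.

(** The projections of a total sequence are total in [L]: a vector of [L] orthogonal to all of them
    is orthogonal to every [d n]. Gram-Schmidt is then applied to these projections. *)
Lemma subspace_suborthonormal d L : closed_span (range d) = setT ->
  hilbert_subspace L ->
  exists2 h, suborthonormal h & closed_span (range h) = L.
Proof.
move=> dT HL.
have /choice[p pP] : forall n, exists p, L p /\ orthocompl L (d n - p).
  by move=> n; have [p] := projection_exists (d n) HL; exists p.
have [h ho hp] := gram_schmidt p; exists h => //; rewrite hp.
apply/seteqP; split.
  by apply: closed_span_min => // _ [n _ <-]; have [] := pP n.
move=> x Lx.
have [m [q [Mm Mq xE]]] := subspace_split x (closed_span_subspace (range p)).
have Lm : L m by apply: (closed_span_min HL) Mm => _ [n _ <-]; have [] := pP n.
have Lq : L q by rewrite (_ : q = x - m); [exact: (subspaceB HL)|rewrite xE addrC addKr].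
suff q0 : q = 0 by rewrite xE q0 addr0.
apply: (@orthocompl_disjoint _ _ setT) => //.
rewrite -dT; apply: orthocompl_closed_span => _ [n _ <-].
rewrite -(subrK (p n) (d n)) innerDr (inner_eq0C ((pP n).2 _ Lq)) add0r.
by apply: Mq; apply: closed_span_subset; exists n.
Qed.

Lemma separable_closed_span : separable H -> exists d, closed_span (range d) = setT.
Proof.
move=> [D cD dD].
have [D0|] := pfcard_geP cD; last first.
  move=> [f]; exists f; apply/seteqP; split => // x _.
  apply/closure_rnormP => eps eps0.
  have [||y [xy Dy]] := dD (ball x (eps%:C)%C).
  - by exists x; apply: ballxx; rewrite ltcR.
  - exact: ball_open.
  have [n _ fn] := @surj _ _ _ _ f y Dy.
  exists y; first by apply: linear_span_subset; exists n.
  by move: xy; rewrite -ball_normE /ball_ /= -rnormE ltcR.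
have [|y] := dD setT _ openT; first by exists 0.
by rewrite D0 setTI.
Qed.

(** Passage from a sequence with zeros to a basis that is a set, the form in which dimensions are
    compared. Nonzero members at different indices are different vectors, so no multiplicity is
    lost. *)
Lemma suborthonormal_basis h : suborthonormal h ->
  orthonormal_basis (closed_span (range h)) (range h `\ 0) id.
Proof.
move=> ho; split.
  move=> _ _ [[i _ <-] /eqP hi] [[j _ <-] /eqP hj].
  rewrite ho hi andbT; case: (eqVneq i j) => [->|ij]; first by rewrite eqxx.
  case: (eqVneq (h i) (h j)) => // hij.
  have := ho i j; rewrite hij ho eqxx hj (negbTE ij) /= => /eqP.
  by rewrite oner_eq0.
have Hh := closed_span_subspace (range h).
have Hh' := closed_span_subspace (id @` (range h `\ 0)).
apply/seteqP; split; apply: closed_span_min => //.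
  by move=> _ [_ [[i _ <-] _] <-]; apply: closed_span_subset; exists i.
move=> _ [i _ <-]; have [->|hi] := eqVneq (h i) 0; first exact: subspace0.
apply: closed_span_subset; exists (h i) => //; split; first by exists i.
exact/eqP.
Qed.

End gram_schmidt.

(** * Hilbert-Schmidt sums and their invariance under adjoints *)

Section hilbert_schmidt_sums.
Variables (R : realType).

(** Expand each |X b_k|^2 along [h], exchange the two sums of nonnegative terms, move [X] to the
    other side and apply Bessel for [b]. *)
Lemma hs_le (E H : hilbertType R) (b : nat -> E) (h : nat -> H)
    (X : E -> H) (Xs : H -> E) :
  (forall x y, inner (X x) y = inner x (Xs y)) ->
  bessel_family b -> parseval_family h ->
  (\sum_(0 <= k <oo) (rnorm (X (b k)) ^+ 2)%:E <=
   \sum_(0 <= k <oo) (rnorm (Xs (h k)) ^+ 2)%:E)%E.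
Proof.
move=> XXs bb hp.
under eq_eseriesr do rewrite -hp.
rewrite nneseries_interchange; last by move=> i j; rewrite lee_fin sqr_ge0.
apply: lee_nneseries => [k _ _|k _].
  by apply: nneseries_ge0 => n _ _; rewrite lee_fin sqr_ge0.
under eq_eseriesr do rewrite XXs innerC rnorm_conj.
exact: bb.
Qed.

Lemma hs_eq (E H : hilbertType R) (b : nat -> E) (h : nat -> H)
    (X : E -> H) (Xs : H -> E) :
  (forall x y, inner (X x) y = inner x (Xs y)) ->
  parseval_family b -> parseval_family h ->
  (\sum_(0 <= k <oo) (rnorm (X (b k)) ^+ 2)%:E =
   \sum_(0 <= k <oo) (rnorm (Xs (h k)) ^+ 2)%:E)%E.
Proof.
move=> XXs bp hp; apply/eqP; rewrite eq_le; apply/andP; split.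
  by apply: hs_le => //; exact: parseval_bessel.
apply: hs_le => //; last exact: parseval_bessel.
by move=> x y; rewrite innerC -XXs -innerC.
Qed.

Definition square_norm_summable (H : hilbertType R) (x : nat -> H) :=
  (\sum_(0 <= k <oo) (rnorm (x k) ^+ 2)%:E < +oo)%E.

Section square_norm_summable_theory.
Variable H : hilbertType R.
Implicit Types x y : nat -> H.

Lemma square_norm_summable_cvg x : square_norm_summable x ->
  cvgn (series (fun k => rnorm (x k) ^+ 2)).
Proof. by apply: nneseries_cvg => k; exact: sqr_ge0. Qed.

Lemma square_norm_summable_le (H' : hilbertType R) (c : R) x (y : nat -> H') :
  (forall k, rnorm (y k) <= c * rnorm (x k)) ->
  square_norm_summable x -> square_norm_summable y.
Proof.
move=> yx sx.
apply: (@nneseries_lt _ _ (fun k => c ^+ 2 * rnorm (x k) ^+ 2)).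
  move=> k; rewrite sqr_ge0 /= -exprMn ler_pXn2r ?nnegrE ?rnorm_ge0 //.
  exact: le_trans (rnorm_ge0 _) (yx k).
under eq_eseriesr do rewrite EFinM.
rewrite nneseriesZl; last by move=> k _; rewrite lee_fin sqr_ge0.
apply: lte_mul_pinfty => //; first by rewrite lee_fin sqr_ge0.
Qed.

Lemma square_norm_summableD x y : square_norm_summable x ->
  square_norm_summable y -> square_norm_summable (fun k => x k + y k).
Proof.
move=> sx sy.
apply: (@nneseries_lt _ _ (fun k => 2 * rnorm (x k) ^+ 2 + 2 * rnorm (y k) ^+ 2)).
  move=> k; rewrite sqr_ge0 /=; have := parallelogram (x k) (y k).
  have := sqr_ge0 (rnorm (x k - y k)); lra.
under eq_eseriesr do rewrite EFinD !EFinM.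
rewrite nneseriesD; do ?[by move=> *; rewrite lee_fin mulr_ge0 ?sqr_ge0].
rewrite !nneseriesZl; do ?[by move=> *; rewrite lee_fin sqr_ge0].
by apply: lte_add_pinfty; apply: lte_mul_pinfty.
Qed.

Lemma square_norm_summableN x : square_norm_summable x ->
  square_norm_summable (fun k => - x k).
Proof.
by apply: square_norm_summable_le => k; rewrite rnormN -[leLHS]mul1r.
Qed.

Lemma square_norm_summableB x y : square_norm_summable x ->
  square_norm_summable y -> square_norm_summable (fun k => x k - y k).
Proof. by move=> sx sy; apply: square_norm_summableD => //; exact: square_norm_summableN. Qed.

Lemma Re_inner_polar (a b : H) : complex.Re (inner a b) =
  4^-1 * rnorm (a + b) ^+ 2 - 4^-1 * rnorm (a - b) ^+ 2.
Proof. by rewrite rnormD_sq rnormB_sq; field. Qed.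

Lemma Re_inner_cvg x y : square_norm_summable x -> square_norm_summable y ->
  cvgn (series (fun k => complex.Re (inner (x k) (y k)))).
Proof.
move=> sx sy; under eq_fun do rewrite Re_inner_polar.
have cD := square_norm_summable_cvg (square_norm_summableD sx sy).
have cB := square_norm_summable_cvg (square_norm_summableB sx sy).
by apply: is_cvg_seriesB; exact: is_cvg_seriesZ.
Qed.

Lemma limn_Re_inner_polar x y : square_norm_summable x -> square_norm_summable y ->
  limn (series (fun k => complex.Re (inner (x k) (y k)))) =
  4^-1 * limn (series (fun k => rnorm (x k + y k) ^+ 2)) -
  4^-1 * limn (series (fun k => rnorm (x k - y k) ^+ 2)).
Proof.
move=> sx sy; under eq_fun do rewrite Re_inner_polar.
have cD := square_norm_summable_cvg (square_norm_summableD sx sy).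
have cB := square_norm_summable_cvg (square_norm_summableB sx sy).
rewrite lim_seriesB; do ?exact: is_cvg_seriesZ.
by rewrite !lim_seriesZ.
Qed.

Lemma limn_square_norm x : square_norm_summable x ->
  (\sum_(0 <= k <oo) (rnorm (x k) ^+ 2)%:E =
   (limn (series (fun k => rnorm (x k) ^+ 2)))%:E)%E.
Proof. by move=> /square_norm_summable_cvg cx; exact: nneseries_cvgE. Qed.

End square_norm_summable_theory.

Lemma hs_limn_eq (E H : hilbertType R) (b : nat -> E) (h : nat -> H)
    (X : E -> H) (Xs : H -> E) :
  (forall x y, inner (X x) y = inner x (Xs y)) ->
  parseval_family b -> parseval_family h ->
  square_norm_summable (X \o b) ->
  square_norm_summable (Xs \o h) /\
  limn (series (fun k => rnorm (X (b k)) ^+ 2)) =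
  limn (series (fun k => rnorm (Xs (h k)) ^+ 2)).
Proof.
move=> XXs bp hp sX; have e := hs_eq XXs bp hp.
have sXs : square_norm_summable (Xs \o h) by rewrite /square_norm_summable /= -e.
split=> //; apply: EFin_inj.
by rewrite -(limn_square_norm sX) -(limn_square_norm sXs).
Qed.

(** Polarization reduces the claim to [hs_limn_eq] for X + Y and X - Y. It concerns real parts
    because taking adjoints conjugates the Hilbert-Schmidt inner product. *)
Lemma hs_Re_inner_swap (E H : hilbertType R) (b : nat -> E) (h : nat -> H)
    (X Y : E -> H) (Xs Ys : H -> E) :
  (forall x y, inner (X x) y = inner x (Xs y)) ->
  (forall x y, inner (Y x) y = inner x (Ys y)) ->
  parseval_family b -> parseval_family h ->
  square_norm_summable (X \o b) -> square_norm_summable (Y \o b) ->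
  cvgn (series (fun k => complex.Re (inner (Xs (h k)) (Ys (h k))))) /\
  limn (series (fun k => complex.Re (inner (X (b k)) (Y (b k))))) =
  limn (series (fun k => complex.Re (inner (Xs (h k)) (Ys (h k))))).
Proof.
move=> XXs YYs bp hp sX sY.
have [sXs _] := hs_limn_eq XXs bp hp sX; have [sYs _] := hs_limn_eq YYs bp hp sY.
split; first exact: Re_inner_cvg sXs sYs.
rewrite (limn_Re_inner_polar sX sY) (limn_Re_inner_polar sXs sYs).
have XYD x y : inner (X x + Y x) y = inner x (Xs y + Ys y).
  by rewrite innerDl innerDr XXs YYs.
have XYB x y : inner (X x - Y x) y = inner x (Xs y - Ys y).
  by rewrite innerBl innerBr XXs YYs.
have [_ ->] := hs_limn_eq XYD bp hp (square_norm_summableD sX sY).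
by have [_ ->] := hs_limn_eq XYB bp hp (square_norm_summableB sX sY).
Qed.

End hilbert_schmidt_sums.

(** * Hilbert-Schmidt perturbations of the identity *)

Section hilbert_schmidt_perturbation.
Variables (R : realType) (E : hilbertType R).

(** The substitute for compactness: an orthonormal sequence is a Bessel family, so the squares |Q
    x_n|^2 are summable and tend to 0. *)
Lemma hs_no_unit_images (Q Qs : E -> E) (h x : nat -> E) :
  (forall u v, inner (Q u) v = inner u (Qs v)) -> parseval_family h ->
  square_norm_summable (Q \o h) -> orthonormal_family setT x ->
  ~ (forall n, 1 <= rnorm (Q (x n))).
Proof.
move=> QQs hp sQ xo Qx.
have [sQs _] := hs_limn_eq QQs hp hp sQ.
have sx : square_norm_summable (Q \o x).
  apply: le_lt_trans sQs; apply: (hs_le QQs _ hp).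
  exact/suborthonormal_bessel/orthonormal_suborthonormal.
have := cvg_series_cvg_0 (square_norm_summable_cvg sx).
move=> /cvgrPdist_lt /(_ 1 ltr01)[n _ /(_ n (leqnn n))] /=.
rewrite sub0r normrN ger0_norm ?sqr_ge0 // ltNge -[leLHS](expr1n _ 2).
by rewrite ler_pXn2r ?nnegrE ?rnorm_ge0 // Qx.
Qed.

(* The Fredholm alternative for I - Q with Q Hilbert-Schmidt: otherwise the
   kernels of the powers of T increase strictly, and unit vectors x_n of
   ker T^(n+1) orthogonal to ker T^n satisfy <Q x_n, x_n> = 1. *)
Lemma hs_perturbation_injective (T : {linear E -> E}) (Ts : E -> E) (h : nat -> E) :
  (forall x y, inner (T x) y = inner x (Ts y)) -> parseval_family h ->
  square_norm_summable (fun k => h k - T (h k)) ->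
  (forall y, exists x, T x = y) -> forall x, T x = 0 -> x = 0.
Proof.
move=> TTs hp sQ /choice[g Tg] a Ta; apply: contrapT => /eqP a0.
pose L n := [set x | iter n T x = 0].
have iterTs n x y : inner (iter n T x) y = inner x (iter n Ts y).
  by elim: n x y => // n IH x y; rewrite iterS TTs IH -iterSr.
(* [T] is not assumed bounded; the kernels of its powers are closed because they are orthogonal
   complements of ranges of powers of [Ts]. *)
have HL n : hilbert_subspace (L n).
  rewrite (_ : L n = orthocompl (range (iter n Ts))).
    exact: orthocompl_subspace.
  apply/seteqP; split=> x.
    by move=> Lx _ [y _ <-]; rewrite -iterTs Lx inner0l.
  move=> Lx; apply: inner_inj => z; rewrite inner0l iterTs.
  by apply: Lx; exists z.
have LT n x : L n.+1 x -> L n (T x) by rewrite /L /= -iterSr.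
have LS m n : (m <= n)%N -> L m `<=` L n.
  move=> mn x; rewrite /L /= -[in X in _ -> X](subnK mn) iterD => ->.
  by elim: (n - m)%N => //= k ->; rewrite linear0.
have iter_g n : iter n T (iter n g a) = a.
  by elim: n => // n IH; rewrite iterSr iterS Tg.
(* The n-th preimage of [a] lies in [L n.+1] but not in [L n], since [iter n T] sends it to [a],
   which is nonzero; hence its component orthogonal to [L n] does not vanish. *)
have /choice[w wP] : forall n, exists w, [/\ L n.+1 w, orthocompl (L n) w & w != 0].
  move=> n; have [p [q [Lp Lq yE]]] := subspace_split (iter n g a) (HL n).
  exists q; split => //.
    rewrite (_ : q = iter n g a - p); last by rewrite yE addrC addKr.
    apply: (subspaceB (HL n.+1)); last exact: LS Lp.
    by rewrite /L /= iter_g.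
  apply: contra_neq a0 => q0; rewrite -(iter_g n) yE q0 addr0; exact: Lp.
pose x n := ((rnorm (w n))^-1)%:C%C *: w n.
have xL n : L n.+1 (x n) by apply: (subspaceZ _ (HL _)); have [] := wP n.
have xLc n : orthocompl (L n) (x n).
  by apply: (subspaceZ _ (orthocompl_subspace _)); have [] := wP n.
have xx n : inner (x n) (x n) = 1 by apply: normalizeE; have [] := wP n.
have xo : orthonormal_family setT x.
  have xij i j : (i < j)%N -> inner (x j) (x i) = 0.
    by move=> ij; apply: xLc; exact: LS (xL i).
  move=> i j _ _; have [ij|ji|->] := ltngtP i j.
  - exact/inner_eq0C/xij.
  - exact: xij.
  - by rewrite xx.
have QQs u v : inner (u - T u) v = inner u (v - Ts v).
  by rewrite innerBl innerBr TTs.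
apply: (hs_no_unit_images QQs hp sQ xo) => n.
have xn : rnorm (x n) = 1.
  by apply/eqP; rewrite -(@eqrXn2 _ 2) ?rnorm_ge0 // rnorm_Re xx expr1n.
rewrite -[leRHS]mulr1 -[X in _ * X]xn; apply: le_trans (cauchy_schwarz _ _).
by rewrite innerBl xx (inner_eq0C (xLc n _ (LT _ _ (xL n)))) subr0 rnorm1.
Qed.

(** Meant for Q = I - A, whose fixed vectors are the kernel of A. An infinite [B] would contain an
    orthonormal sequence of fixed unit vectors. *)
Lemma hs_fixed_orthonormal_finite (Q : {linear E -> E}) (h : nat -> E) (B : set E) :
  is_adjoint Q Q -> parseval_family h -> square_norm_summable (Q \o h) ->
  orthonormal_family B id -> (forall x, B x -> Q x = x) -> finite_set B.
Proof.
move=> QQ hp sQ Bo BQ; apply: contrapT => /infiniteP/card_leP[f].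
pose x n : E := val (f (SigSub (mem_set (I : setT n)))).
have xB n : B (x n) by apply: set_mem; exact: valP.
have xo : orthonormal_family setT x.
  move=> i j _ _; rewrite (Bo _ _ (xB i) (xB j)); congr (nat_of_bool _)%:R.
  apply/eqP/eqP => [/val_inj/inj|->] //.
  by move=> /(_ (mem_set I) (mem_set I))/(congr1 val).
apply: (hs_no_unit_images QQ hp sQ xo) => n; rewrite BQ //.
have := Bo _ _ (xB n) (xB n); rewrite eqxx inner_rnorm => /(congr1 (@complex.Re R)) /= xn.
by rewrite -(@ler_pXn2r _ 2) ?nnegrE ?rnorm_ge0 // xn expr1n.
Qed.

(** * Closed range of a self-adjoint A with I - A Hilbert-Schmidt *)

Section selfadjoint.
Variables (A : {linear E -> E}) (h : nat -> E).
Hypothesis A_bounded : bounded_operator A.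
Hypothesis A_sym : is_adjoint A A.
Hypothesis h_parseval : parseval_family h.
Hypothesis IA_hs : square_norm_summable (fun k => h k - A (h k)).

Let N := ker_op A.

Lemma ker_orthocompl_range : ker_op A = orthocompl (range A).
Proof.
apply/seteqP; split=> x.
  by move=> Ax _ [y _ <-]; rewrite -A_sym Ax inner0l.
move=> Ax; apply: inner_inj => z; rewrite inner0l A_sym.
by apply: Ax; exists z.
Qed.

Lemma ker_subspace : hilbert_subspace (ker_op A).
Proof. by rewrite ker_orthocompl_range; exact: orthocompl_subspace. Qed.

Lemma orthocompl_ker_closure : orthocompl (ker_op A) `<=` closure (range A).
Proof.
have HL : hilbert_subspace (closure (range A)).
  apply: closure_subspace; first by exists 0; rewrite ?linear0.
  by move=> a _ _ [x _ <-] [y _ <-]; exists (a *: x + y); rewrite ?linearP.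
rewrite -[X in _ `<=` X](orthocomplK HL) => z zN y yA; apply: zN.
rewrite ker_orthocompl_range => w wA; apply: yA; exact: subset_closure.
Qed.

Lemma inner_le_image (z : E) (eta : R) : 0 < eta ->
  exists2 C, 0 <= C & forall x, orthocompl N x ->
    rnorm (inner x z) ^+ 2 <= C * rnorm (A x) ^+ 2 + eta * rnorm x ^+ 2.
Proof.
move=> eta0; have [p [q [Np Nq zE]]] := subspace_split z ker_subspace.
have /closure_rnormP := orthocompl_ker_closure Nq.
(* The bound (a + b)^2 <= 2 a^2 + 2 b^2 doubles both contributions, whence the half under the root
   and the factor 2 in the witness. *)
move=> /(_ (Num.sqrt (eta / 2)))[|_ [w _ <-] qw].
  by rewrite sqrtr_gt0 divr_gt0.
exists (2 * rnorm w ^+ 2); first by rewrite mulr_ge0 ?sqr_ge0.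
move=> x Nx; rewrite zE innerDr (Nx _ Np) add0r -(subrK (A w) q) innerDr -A_sym.
have h1 := cauchy_schwarz x (q - A w); have h2 := cauchy_schwarz (A x) w.
have h3 := ler_rnormD (inner x (q - A w)) (inner (A x) w).
have h4 : rnorm (q - A w) ^+ 2 <= eta / 2.
  rewrite -[leRHS]sqr_sqrtr ?divr_ge0 ?(ltW eta0) //.
  by rewrite ler_pXn2r ?nnegrE ?rnorm_ge0 ?sqrtr_ge0 // ltW.
apply: (@le_trans _ _ ((rnorm x * rnorm (q - A w) + rnorm (A x) * rnorm w) ^+ 2)).
  rewrite ler_pXn2r ?nnegrE ?rnorm_ge0 ?addr_ge0 ?mulr_ge0 ?rnorm_ge0 //.
  by apply: le_trans h3 _; exact: lerD.
apply: (@le_trans _ _ (2 * (rnorm x ^+ 2 * rnorm (q - A w) ^+ 2) +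
                       2 * (rnorm (A x) ^+ 2 * rnorm w ^+ 2))).
  have := sqr_ge0 (rnorm x * rnorm (q - A w) - rnorm (A x) * rnorm w).
  by rewrite -!exprMn; lra.
have := ler_wpM2l (sqr_ge0 (rnorm x)) h4; lra.
Qed.

Lemma sum_inner_le_image (z : nat -> E) n (eta : R) : 0 < eta ->
  exists2 C, 0 <= C & forall x, orthocompl N x ->
    \sum_(0 <= k < n) rnorm (inner x (z k)) ^+ 2 <=
      C * rnorm (A x) ^+ 2 + eta * rnorm x ^+ 2.
Proof.
elim: n eta => [|n IH] eta eta0.
  by exists 0 => // x _; rewrite big_geq // mul0r add0r mulr_ge0 ?sqr_ge0 ?ltW.
have eta2 : 0 < eta / 2 by rewrite divr_gt0.
have [C1 C10 h1] := IH _ eta2; have [C2 C20 h2] := inner_le_image (z n) eta2.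
exists (C1 + C2); first exact: addr_ge0.
move=> x Nx; rewrite big_nat_recr //=; have := h1 x Nx; have := h2 x Nx; lra.
Qed.

(* Up to a small multiple of |x|^2, |x - A x|^2 is a finite sum of terms
   |<x, z_k>|^2 with z_k = h_k - A h_k, and each is controlled by |A x| because
   the projection of z_k orthogonal to the kernel is a limit of vectors A w. *)
Lemma hs_selfadjoint_bounded_below : exists2 c, 0 < c &
  forall x, orthocompl N x -> rnorm x <= c * rnorm (A x).
Proof.
pose z k := h k - A (h k).
have /cvg_ex[l sl] := square_norm_summable_cvg IA_hs.
have ndz : nondecreasing_seq (series (fun k => rnorm (z k) ^+ 2)).
  by apply: nondecreasing_series => k _ _; exact: sqr_ge0.
have sle n : series (fun k => rnorm (z k) ^+ 2) n <= l.
  rewrite -(cvg_lim _ sl) //; apply: nondecreasing_cvgn_le => //.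
  by apply/cvg_ex; exists l.
have e80 : 0 < 8^-1 :> R by rewrite invr_gt0.
have [n _ /(_ n (leqnn n))/= ln] := (cvgrPdist_lt _ _).1 sl 8^-1 e80.
have [C C0 hC] := @sum_inner_le_image z n 8^-1 e80.
(* Head and tail contribute |x|^2/8 each, so |x - A x|^2 <= C |A x|^2 + |x|^2/4. With |x|^2 <= 2 |A
   x|^2 + 2 |x - A x|^2, half of |x|^2 is absorbed on the left and 4 + 4C remains. *)
exists (Num.sqrt (4 + 4 * C)); first by rewrite sqrtr_gt0 ltr_wpDr // mulr_ge0.
move=> x Nx; set q := rnorm x ^+ 2.
have q0 : 0 <= q by exact: sqr_ge0.
have inner_z k : inner (x - A x) (h k) = inner x (z k).
  by rewrite innerBl innerBr A_sym.
have KxP : rnorm (x - A x) ^+ 2 <= C * rnorm (A x) ^+ 2 + 8^-1 * q + q * 8^-1.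
  rewrite -lee_fin -h_parseval; apply: nneseries_le => [k|m]; first exact: sqr_ge0.
  rewrite lee_fin; under eq_bigr do rewrite inner_z.
  apply: (@le_trans _ _ (\sum_(0 <= k < maxn n m) rnorm (inner x (z k)) ^+ 2)).
    rewrite [leRHS](big_cat_nat (n := m)) ?leq_maxr //= lerDl.
    by rewrite sumr_ge0 // => k _; exact: sqr_ge0.
  rewrite (big_cat_nat (n := n)) ?leq_maxl //=; apply: lerD; first exact: hC.
  apply: (@le_trans _ _ (\sum_(n <= k < maxn n m) q * rnorm (z k) ^+ 2)).
    apply: ler_sum => k _; rewrite -exprMn.
    by rewrite ler_pXn2r ?nnegrE ?rnorm_ge0 ?mulr_ge0 ?rnorm_ge0 // cauchy_schwarz.
  rewrite -mulr_sumr ler_wpM2l // -sub_series_geq ?leq_maxl //.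
  have := sle (maxn n m); move: ln; rewrite ltr_norml => /andP[_ ln] sm; lra.
rewrite -(@ler_pXn2r _ 2) ?nnegrE ?rnorm_ge0 ?mulr_ge0 ?rnorm_ge0 ?sqrtr_ge0 //.
rewrite exprMn sqr_sqrtr ?addr_ge0 ?mulr_ge0 // -/q.
have := parallelogram (A x) (x - A x); rewrite (addrC (A x) (x - A x)) subrK -/q.
have := sqr_ge0 (rnorm (A x - (x - A x))); lra.
Qed.

(** [z] is a limit of vectors A w_n. Once their kernel components are removed, the w_n satisfy the
    lower bound, hence form a Cauchy sequence whose limit is the preimage. *)
Lemma hs_selfadjoint_range z : orthocompl N z ->
  exists2 x, orthocompl N x & A x = z.
Proof.
move=> Nz; have [c c0 cA] := hs_selfadjoint_bounded_below.
have [M M0 AM] := (bounded_rnormP A).1 A_bounded.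
have HNc := orthocompl_subspace N.
have /closure_rnormP cz := orthocompl_ker_closure Nz.
have /choice[w wP] : forall n, exists w, orthocompl N w /\ rnorm (z - A w) < n.+1%:R^-1.
  move=> n; have [|_ [y _ <-] zy] := cz n.+1%:R^-1; first by rewrite invr_gt0.
  have [p [q [Np Nq yE]]] := subspace_split y ker_subspace.
  by exists q; split => //; move: zy; rewrite yE linearD /= (Np : A p = 0) add0r.
have [|x wx] := @cauchy_rnorm_cvg _ _ w.
  move=> eps eps0; have [|n0 nP] := @invS_lt R (eps / (c * 2)).
    by rewrite divr_gt0 // mulr_gt0.
  exists n0 => m n /nP mlt /nP nlt.
  apply: le_lt_trans (cA _ _) _; first
    by apply: (subspaceB HNc); [exact: (wP m).1|exact: (wP n).1].
  have h1 := ler_rnorm_dist z (A (w m)) (A (w n)).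
  rewrite linearB /=; move: h1; rewrite (rnorm_distC _ z) => h1.
  have h2 := lt_trans (wP m).2 mlt; have h3 := lt_trans (wP n).2 nlt.
  rewrite mulrC -ltr_pdivlMr //; apply: le_lt_trans h1 _.
  apply: lt_le_trans (ltrD h2 h3) _.
  by rewrite le_eqVlt; apply/orP; left; apply/eqP; field; rewrite gt_eqF.
exists x; first exact: (subspace_cvg HNc (fun n => (wP n).1) wx).
apply/eqP; rewrite -subr_eq0; apply/eqP/rnorm_le_eps0 => eps eps0.
have e20 : 0 < eps / 2 by rewrite divr_gt0.
move/cvg_rnormP : wx => /(_ (eps / 2 / M))[|n1 n1P]; first by rewrite divr_gt0.
have [n2 n2P] := @invS_lt R _ e20.
pose n := maxn n1 n2; have := n1P n (leq_maxl _ _); have := n2P n (leq_maxr _ _).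
move=> nlt; rewrite ltr_pdivlMr // mulrC => xw.
apply: le_lt_trans (ler_rnorm_dist (A (w n)) _ _) _.
rewrite (splitr eps) (rnorm_distC _ z); apply: ltrD; last exact: lt_trans (wP n).2 nlt.
by rewrite -linearB; apply: le_lt_trans (AM _) xw.
Qed.

End selfadjoint.

(** Over the complex numbers a real-valued quadratic form is already symmetric: its vanishing
    imaginary part is polarized at x + y and at x + iy. *)
Lemma positive_selfadjoint (A : {linear E -> E}) : positive_operator A -> is_adjoint A A.
Proof.
move=> A0.
have ImA x : complex.Im (inner (A x) x) = 0 by exact: ger0_Im.
have ImAD x y : complex.Im (inner (A x) y) + complex.Im (inner (A y) x) = 0.
  have := ImA (x + y); rewrite linearD innerDl !innerDr !Im_add !ImA addr0 add0r.
  by rewrite addrC.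
move=> x y; rewrite [RHS]innerC; apply/eqP; rewrite eq_complex Defs.Re_conj Defs.Im_conj.
apply/andP; split; apply/eqP; last by apply/eqP; rewrite -addr_eq0 ImAD.
have := ImAD x ('i%C *: y).
rewrite [A ('i%C *: y)]linearZ /= innerZl innerZr !Im_mul /=.
by rewrite !mul0r !mul1r !add0r mulN1r => /eqP; rewrite addrC subr_eq0 eq_sym => /eqP.
Qed.

(** At z - s A z the form has real part s^2 c - 2 s q with q = |A z|^2, which is negative for small
    positive s unless q = 0. The choice s = q / (c + 1) avoids dividing by c, which may be 0. *)
Lemma positive_null (A : {linear E -> E}) (z : E) : positive_operator A ->
  complex.Re (inner (A z) z) = 0 -> A z = 0.
Proof.
move=> A0 Az; have As := positive_selfadjoint A0.
set q := rnorm (A z) ^+ 2; set c := complex.Re (inner (A (A z)) (A z)).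
have ReA0 x : 0 <= complex.Re (inner (A x) x).
  by have := A0 x; rewrite lecE => /andP[].
have c0 : 0 <= c := ReA0 (A z).
have quad (s : R) : 0 <= s ^+ 2 * c - 2 * s * q.
  have := ReA0 (z - s%:C%C *: A z).
  rewrite [A (_ - _)]linearB [A (_ *: _)]linearZ /= !innerBl !innerBr !innerZl !innerZr.
  rewrite conjC_real (As (A z) z) !raddfB /= Az.
  rewrite !Re_mul /= !mul0r !subr0 -rnorm_Re -/q -/c => /le_trans; apply.
  by rewrite le_eqVlt; apply/orP; left; apply/eqP; ring.
have q0 : 0 <= q by exact: sqr_ge0.
apply/eqP; rewrite -rnorm_eq0 -sqrf_eq0 -/q; apply/eqP.
have c10 : 0 < c + 1 by rewrite ltr_wpDl.
have := quad (q / (c + 1)).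
have -> : (q / (c + 1)) ^+ 2 * c - 2 * (q / (c + 1)) * q =
    - (q ^+ 2 * ((c + 2) / (c + 1) ^+ 2)) by field; rewrite gt_eqF.
rewrite oppr_ge0 => h; apply/eqP; rewrite -sqrf_eq0 eq_le sqr_ge0 andbT.
by move: h; rewrite pmulr_lle0 // divr_gt0 ?exprn_gt0 // ltr_wpDl.
Qed.

End hilbert_schmidt_perturbation.

Lemma series_lincomb (R : realType) (a b : R) (u v w : nat -> R) :
  cvgn (series u) -> cvgn (series v) -> (forall k, w k = a * u k + b * v k) ->
  cvgn (series w) /\ limn (series w) = a * limn (series u) + b * limn (series v).
Proof.
move=> cu cv wE; rewrite (_ : w = (a *: u : nat -> R) + (b *: v : nat -> R)); last first.
  exact/funext.
split; first by apply: is_cvg_seriesD; exact: is_cvg_seriesZ.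
by rewrite lim_seriesD; do ?exact: is_cvg_seriesZ; rewrite !lim_seriesZ.
Qed.

(** * The trace formula for the excess distance *)

Section hs_gap.
Variables (R : realType) (E H : hilbertType R).

Lemma isometry_adjoint_le (M : E -> H) (Ms : H -> E) :
  (forall x y, inner (M x) y = inner x (Ms y)) ->
  (forall x, rnorm (M x) = rnorm x) -> forall y, rnorm (Ms y) <= rnorm y.
Proof.
move=> MMs Mn y; rewrite -[leRHS]mul1r.
by apply: (adjoint_bounded ler01 MMs) => x; rewrite Mn mul1r.
Qed.

(* With D = M - U, the identity U^* D + D^* U + D^* D = 0 and the invariance of
   the Hilbert-Schmidt inner product under taking adjoints give
   |M - U A|^2 - |U - U A|^2 = tr (D A D^* ). *)
Lemma hs_gap (e : nat -> E) (h : nat -> H) (M U : {linear E -> H})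
    (Ms Us : {linear H -> E}) (A : {linear E -> E}) :
  parseval_family e -> parseval_family h ->
  is_adjoint M Ms -> is_adjoint U Us -> is_adjoint A A ->
  (forall x, rnorm (M x) = rnorm x) -> (forall x, rnorm (U x) = rnorm x) ->
  square_norm_summable (fun k => e k - A (e k)) ->
  square_norm_summable (fun k => M (e k) - U (A (e k))) ->
  let d k := Ms (h k) - Us (h k) in
  cvgn (series (fun k => complex.Re (inner (A (d k)) (d k)))) /\
  limn (series (fun k => rnorm (M (e k) - U (A (e k))) ^+ 2)) =
  limn (series (fun k => rnorm (e k - A (e k)) ^+ 2)) +
  limn (series (fun k => complex.Re (inner (A (d k)) (d k)))).
Proof.
move=> ep hp MMs UUs AA Mn Un sK sX d.
pose D x := M x - U x; pose Ds y := Ms y - Us y; pose K x := x - A x.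
have DDs x y : inner (D x) y = inner x (Ds y) by rewrite innerBl innerBr MMs UUs.
have KK x y : inner (K x) y = inner x (K y) by rewrite innerBl innerBr AA.
have sUK : square_norm_summable (U \o K \o e).
  by apply: (square_norm_summable_le (c := 1)) sK => k; rewrite /= Un mul1r.
(* Neither [M] nor [U] is Hilbert-Schmidt, but their difference is: it equals (M - U A) - U K, and
   both terms are square summable along [e]. *)
have DE x : D x = M x - U (A x) - U (K x) by rewrite /D /K linearB opprB addrA subrK.
have sD : square_norm_summable (D \o e).
  rewrite (_ : D \o e = fun k => M (e k) - U (A (e k)) - U (K (e k))).
    exact: square_norm_summableB.
  by apply/funext => k; exact: DE.
have Dle x : rnorm (D x) <= 2 * rnorm x.
  by apply: le_trans (ler_rnormB _ _) _; rewrite Mn Un; lra.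
have sDK : square_norm_summable (D \o K \o e).
  by apply: square_norm_summable_le sK => k; exact: Dle.
have UsDU x y : inner (Us (D x)) y = inner x (Ds (U y)).
  by rewrite innerC -UUs -innerC DDs.
have sUsD : square_norm_summable (Us \o D \o e).
  apply: (square_norm_summable_le (c := 1)) sD => k; rewrite mul1r.
  exact: isometry_adjoint_le UUs Un _.
have DKs x y : inner (D (K x)) y = inner x (K (Ds y)) by rewrite DDs KK.
pose s1 k := complex.Re (inner (D (e k)) (U (K (e k)))).
pose s2 k := complex.Re (inner (U (e k)) (D (K (e k)))).
pose s3 k := complex.Re (inner (D (e k)) (D (K (e k)))).
(* Transposing the pair U^* D and K, with adjoints D^* U and K, makes the sums of [s1] and [s2]
   agree, although their terms need not. *)
have [c2 l12] : cvgn (series s2) /\ limn (series s1) = limn (series s2).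
  have [] := hs_Re_inner_swap UsDU KK ep ep sUsD sK.
  rewrite (_ : s1 = fun k => complex.Re (inner (Us (D (e k))) (K (e k)))); last first.
    by apply/funext => k; rewrite /s1 Re_innerC UUs Re_innerC.
  rewrite (_ : s2 = fun k => complex.Re (inner (Ds (U (e k))) (K (e k)))) //.
  by apply/funext => k; rewrite /s2 Re_innerC DDs Re_innerC.
have c1 : cvgn (series s1) by exact: Re_inner_cvg sD sUK.
have iM x y : inner (M x) (M y) = inner x y.
  by apply: (@isometry_inner _ _ _ M setT).
have iU x y : inner (U x) (U y) = inner x y.
  by apply: (@isometry_inner _ _ _ U setT).
have s3E k : s3 k = (-1) * s1 k + (-1) * s2 k.
  rewrite /s1 /s2 /s3 /D !innerBl !innerBr iM iU !raddfB /=; ring.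
have [_ l3] := series_lincomb c1 c2 s3E.
have [c4 l34] := hs_Re_inner_swap DDs DKs ep hp sD sDK.
have [sDs lD] := hs_limn_eq DDs ep hp sD.
have cD := square_norm_summable_cvg sD; have cDs := square_norm_summable_cvg sDs.
have dE k : complex.Re (inner (A (d k)) (d k)) = 1 * rnorm (Ds (h k)) ^+ 2 +
    (-1) * complex.Re (inner (Ds (h k)) (K (Ds (h k)))).
  rewrite -[d k]/(Ds (h k)); move: (Ds (h k)) => y.
  by rewrite (Re_innerC (A y)) rnorm_Re /K innerBr raddfB /=; ring.
have [cA lA] := series_lincomb cDs c4 dE.
split=> //.
have DK k : rnorm (D (e k)) ^+ 2 + 2 * s1 k = 1 * rnorm (D (e k)) ^+ 2 + 2 * s1 k.
  by rewrite mul1r.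
have [cDK lDK] := series_lincomb cD c1 DK.
(* As M - U A = D + U K, the squared distance is |K|^2 + |D|^2 + 2 s1 after summation. There 2 s1 =
   - s3, and carrying |D|^2 - s3's transposed form over to [h] leaves |Ds h_k|^2 - Re <Ds h_k, K Ds
   h_k>, which is the term with A. *)
have XE k : rnorm (M (e k) - U (A (e k))) ^+ 2 =
    1 * rnorm (e k - A (e k)) ^+ 2 + 1 * (rnorm (D (e k)) ^+ 2 + 2 * s1 k).
  rewrite (_ : M (e k) - U (A (e k)) = D (e k) + U (K (e k))).
    by rewrite (rnormD_sq (D (e k))) Un /s1 /K; ring.
  by rewrite DE subrK.
have [_ ->] := series_lincomb (square_norm_summable_cvg sK) cDK XE.
(* Signs: [l3] and [l12] give that the sum of [s3] is minus twice that of [s1], while [l34]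
   transposes the sum of [s3]. *)
rewrite lDK lA -lD -l34 [limn (series (fun k => complex.Re (inner (D _) (D (K _)))))]l3 -l12.
by rewrite /D /K; ring.
Qed.

End hs_gap.

(** * Finite orthonormal families *)

Section finite_orthonormal.
Variables (R : realType) (H : hilbertType R) (I : eqType) (r : seq I) (g : I -> H).
Hypothesis r_uniq : uniq r.
Hypothesis g_orthonormal : orthonormal_family [set` r] g.

Lemma finite_orthonormal_coef (c : I -> R[i]) i : i \in r ->
  inner (\sum_(j <- r) c j *: g j) (g i) = c i.
Proof.
move=> ir; rewrite inner_suml (bigD1_seq i) //= innerZl g_orthonormal // eqxx mulr1.
rewrite big_seq_cond big1 ?addr0 // => j /andP[jr ji].
by rewrite innerZl g_orthonormal // (negbTE ji) mulr0.
Qed.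

Lemma finite_orthonormal_norm (c : I -> R[i]) :
  rnorm (\sum_(j <- r) c j *: g j) ^+ 2 = \sum_(j <- r) rnorm (c j) ^+ 2.
Proof.
apply: complexI; rewrite -inner_rnorm inner_sumr rmorph_sum /= big_seq [RHS]big_seq.
apply: eq_bigr => i ir; rewrite innerZr finite_orthonormal_coef //.
by rewrite mulrC -normCK -rnormE -rmorphXn.
Qed.

Lemma finite_orthonormal_expansion x : closed_span (g @` [set` r]) x ->
  x = \sum_(j <- r) inner x (g j) *: g j.
Proof.
move=> gx; have HL := closed_span_subspace (g @` [set` r]).
apply/eqP; rewrite -subr_eq0; apply/eqP.
apply: (orthocompl_disjoint (L := closed_span (g @` [set` r]))).
  apply: (subspaceB HL) => //; rewrite big_seq.
  apply: (subspace_sum _ HL) => j jr; apply: (subspaceZ _ HL).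
  by apply: closed_span_subset; exists j.
apply: orthocompl_closed_span => _ [j jr <-].
by rewrite innerBl (finite_orthonormal_coef (fun i => inner x (g i))) // subrr.
Qed.

End finite_orthonormal.

(** * Comparison of cardinals through lists and functions *)

Section cardinals.
Variables (T U : choiceType).

Lemma card_le_seq (A : set T) (B : set U) (x : T) (y : U) (s : seq T) (t : seq U) :
  uniq t -> A = [set` s] -> B = [set` t] -> (size s <= size t)%N -> (A #<= B)%card.
Proof.
move=> tu -> -> st.
apply: (card_le_trans (B := `I_(size s))).
  apply: (card_le_trans _ (card_image_le (nth x s) `I_(size s))).
  apply: subset_card_le => z /= zs; exists (index z s); rewrite /= ?index_mem //.
  exact: nth_index.
apply: (card_le_trans (B := `I_(size t))); first by rewrite card_le_II.
apply: (card_le_trans _ (card_image_le (index^~ t) [set` t])).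
apply: subset_card_le => i /= it; exists (nth y t i); first exact: mem_nth.
exact: index_uniq.
Qed.

(** The injection is extended by the default value [y] outside [A], so that it can occur in sums
    without membership proofs. *)
Lemma card_le_function (A : set T) (B : set U) (y : U) : (A #<= B)%card ->
  exists phi : T -> U, (forall a, A a -> B (phi a)) /\
    forall a b, A a -> A b -> phi a = phi b -> a = b.
Proof.
move=> /card_leP[f].
have /choice[phi phiP] : forall a, exists b, forall (Aa : a \in A), b = val (f (SigSub Aa)).
  move=> a; have [/mem_set Aa|nAa] := pselect (A a); last first.
    by exists y => Aa; case: (nAa (set_mem Aa)).
  by exists (val (f (SigSub Aa))) => Aa'; rewrite (bool_irrelevance Aa' Aa).
exists phi; split=> [a /mem_set Aa|a b /mem_set Aa /mem_set Ab].
  by rewrite (phiP _ Aa); apply: set_mem; exact: valP.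
rewrite (phiP _ Aa) (phiP _ Ab) => /val_inj/inj.
by move=> /(_ (mem_set I) (mem_set I))/(congr1 val).
Qed.

End cardinals.

(** * Partial isometries and bounded operators on a basis *)

Section partial_isometries.
Variables (R : realType) (E H : hilbertType R).
Implicit Types (V T : {linear E -> H}) (N : set E).

Lemma bounded_ker_subspace T : bounded_operator T -> hilbert_subspace (ker_op T).
Proof.
move=> /adjoint_exists[Ts TTs].
rewrite (_ : ker_op T = orthocompl (range Ts)); first exact: orthocompl_subspace.
apply/seteqP; split=> x.
  by move=> Tx _ [y _ <-]; rewrite -TTs Tx inner0l.
by move=> xTs; apply: inner_inj => z; rewrite inner0l TTs; apply: xTs; exists z.
Qed.

Lemma partial_isometry_intro V N : hilbert_subspace N ->
  (forall x, N x -> rnorm (V x) = rnorm x) ->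
  (forall x, orthocompl N x -> V x = 0) ->
  partial_isometry V /\ initial_space V = N.
Proof.
move=> HN VN VNc.
have initE : initial_space V = N.
  rewrite /initial_space (_ : ker_op V = orthocompl N) ?orthocomplK //.
  apply/seteqP; split=> // x; have [p [q [Np Nq ->]]] := subspace_split x HN.
  rewrite /ker_op /= linearD /= (VNc _ Nq) addr0 => Vp.
  have /eqP : rnorm p = 0 by rewrite -VN // Vp rnorm0.
  by rewrite rnorm_eq0 => /eqP ->; rewrite add0r.
split=> //; split=> [|x]; last by rewrite initE => /VN; rewrite -!rnormE => ->.
apply/bounded_rnormP; exists 1 => // x.
have [p [q [Np Nq ->]]] := subspace_split x HN.
rewrite linearD /= (VNc _ Nq) addr0 VN // mul1r.
rewrite -(@ler_pXn2r _ 2) ?nnegrE ?rnorm_ge0 // pythagoras; first by rewrite lerDl sqr_ge0.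
exact: orthocompl_inner Np Nq.
Qed.

Lemma partial_isometry_elim V N : hilbert_subspace N ->
  partial_isometry V -> initial_space V = N ->
  (forall x, N x -> rnorm (V x) = rnorm x) /\
  (forall x, orthocompl N x -> V x = 0).
Proof.
move=> HN [Vb Vi] VN; split=> x.
  by rewrite -VN => /Vi; rewrite /rnorm => ->.
by rewrite -VN /initial_space orthocomplK //; exact: bounded_ker_subspace.
Qed.

Lemma bounded_eq0 T (e : nat -> E) : bounded_operator T ->
  closed_span (range e) = setT -> (forall i, T (e i) = 0) -> forall x, T x = 0.
Proof.
move=> /adjoint_exists[Ts TTs] eT Te x; apply: inner_inj => y.
rewrite inner0l TTs; apply: inner_eq0C.
have : orthocompl (closed_span (range e)) (Ts y).
  apply: orthocompl_closed_span => _ [i _ <-].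
  by apply: inner_eq0C; rewrite -TTs Te inner0l.
by apply; rewrite eT.
Qed.

(** If y is orthogonal to every T e_i, then [Ts y] is orthogonal to the total family [e], hence 0,
    and y is orthogonal to the whole range; closedness of the range does the rest. *)
Lemma closed_span_image T (e : nat -> E) : bounded_operator T ->
  closed_span (range e) = setT -> hilbert_subspace (range T) ->
  closed_span (range (T \o e)) = range T.
Proof.
move=> /adjoint_exists[Ts TTs] eT HT; apply/seteqP; split.
  by apply: closed_span_min => // _ [i _ <-]; exists (e i).
have HL := closed_span_subspace (range (T \o e)).
rewrite -[X in _ `<=` X](orthocomplK HL) => _ [x _ <-] y yT.
suff y0 : Ts y = 0 by rewrite TTs y0 inner0r.
apply: (orthocompl_disjoint (L := setT)) => //.
rewrite -eT; apply: orthocompl_closed_span => _ [i _ <-].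
apply: inner_eq0C; rewrite -TTs; apply: inner_eq0C; apply: yT.
by apply: closed_span_subset; exists i.
Qed.

Lemma bounded_cvg T (u : nat -> E) x : bounded_operator T ->
  u @ \oo --> x -> (fun n => T (u n)) @ \oo --> T x.
Proof.
move=> /bounded_rnormP[M M0 TM] /cvg_rnormP ux; apply/cvg_rnormP => eps eps0.
have [|N uN] := ux (eps / M); first by rewrite divr_gt0.
exists N => n /uN; rewrite ltr_pdivlMr // mulrC -linearB; exact: le_lt_trans.
Qed.

End partial_isometries.

Lemma square_norm_summable_rank1 (R : realType) (E H : hilbertType R)
    (e : nat -> E) (a : E) (b : H) : parseval_family e ->
  square_norm_summable (fun k => inner (e k) a *: b).
Proof.
move=> ep; rewrite /square_norm_summable.
under eq_eseriesr do rewrite rnormZ innerC rnorm_conj mulrC exprMn EFinM.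
rewrite nneseriesZl; last by move=> k _; rewrite lee_fin sqr_ge0.
by rewrite ep -EFinM ltry.
Qed.

Lemma square_norm_summable_sum (R : realType) (H : hilbertType R) (I : Type)
    (r : seq I) (x : I -> nat -> H) :
  (forall i, square_norm_summable (x i)) ->
  square_norm_summable (fun k => \sum_(i <- r) x i k).
Proof.
move=> sx; elim: r => [|i r IH].
  under eq_fun do rewrite big_nil.
  rewrite /square_norm_summable eseries0 ?ltry // => k _ _.
  by rewrite rnorm0 expr0n.
by under eq_fun do rewrite big_cons; exact: square_norm_summableD.
Qed.

(** * Polar decomposition and the minimizing isometries *)

Section symmetric_orthogonalizations.
Variables (R : realType) (H : hilbertType R).
Variables (f : nat -> H) (e : nat -> l2 R).
Variables (F W : {linear l2 R -> H}) (A : {linear l2 R -> l2 R}).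
Hypothesis separable_H : separable H.
Hypothesis e_basis : orthonormal_basis setT setT e.
Hypothesis F_e : forall i, F (e i) = f i.
Hypothesis F_bounded : bounded_operator F.
Hypothesis F_polar : polar_decomposition F W A.
Hypothesis IA_HS : hilbert_schmidt (idfun \- A).

Let N := ker_op F.

Let admissible (V : {linear l2 R -> H}) :=
  [/\ partial_isometry V, initial_space V = ker_op A
    & forall x y, inner (V x) (W y) = 0].

Let e_parseval : parseval_family e := orthonormal_basis_parseval e_basis.

Let A_bounded : bounded_operator A.
Proof. by case: F_polar => -[]. Qed.

Let A_positive : positive_operator A.
Proof. by case: F_polar => -[]. Qed.

Let A_sym : is_adjoint A A := positive_selfadjoint A_positive.

Let F_W x : F x = W (A x).
Proof. by case: F_polar. Qed.

Lemma polar_rnorm x : rnorm (A x) = rnorm (F x).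
Proof.
have [[_ _ [Fs FFs AA]] _ _ _ _] := F_polar.
apply/eqP; rewrite -(@eqrXn2 _ 2) ?rnorm_ge0 //; apply/eqP.
by rewrite !rnorm_Re FFs -AA A_sym.
Qed.

Lemma polar_ker : ker_op A = N.
Proof.
apply/seteqP; split=> x /= Ax; apply/eqP; rewrite -rnorm_eq0.
  by rewrite -polar_rnorm Ax rnorm0.
by rewrite polar_rnorm Ax rnorm0.
Qed.

Let N_subspace : hilbert_subspace N := bounded_ker_subspace F_bounded.

Let W_isometry : (forall x, orthocompl N x -> rnorm (W x) = rnorm x) /\
  (forall x, N x -> W x = 0).
Proof.
have [_ _ Wp Wi _] := F_polar.
have := partial_isometry_elim (orthocompl_subspace N) Wp Wi.
by rewrite orthocomplK.
Qed.

(** The hypothesis provides finiteness along some basis; self-adjointness of I - A carries it over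
    to [e]. *)
Let IA_e : square_norm_summable (fun k => e k - A (e k)).
Proof.
have [_ [b /orthonormal_basis_parseval bp sb]] := IA_HS.
have QQ : is_adjoint (idfun \- A) (idfun \- A).
  by move=> x y /=; rewrite innerBl innerBr A_sym.
by rewrite /square_norm_summable -(hs_eq QQ bp e_parseval).
Qed.

Lemma orthocompl_ker_range z : orthocompl N z -> exists x, A x = z.
Proof.
rewrite -polar_ker => Nz.
by have [x _ xz] := hs_selfadjoint_range A_bounded A_sym e_parseval IA_e Nz; exists x.
Qed.

Lemma polar_bounded_below : exists2 c : R, 0 < c &
  forall x, orthocompl N x -> rnorm x <= c * rnorm (F x).
Proof.
have [c c0 cA] := hs_selfadjoint_bounded_below A_sym e_parseval IA_e.
by exists c => // x; rewrite -polar_ker -polar_rnorm => /cA.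
Qed.

(** [W] depends only on the component orthogonal to N, and every such vector is of the form A y,
    because A has closed range. *)
Lemma polar_range : range W = range F.
Proof.
apply/seteqP; split=> _ [x _ <-]; last by exists (A x) => //; rewrite F_W.
have [p [q [Np Nq ->]]] := subspace_split x N_subspace.
have [y <-] := orthocompl_ker_range Nq.
by exists y => //; rewrite linearD /= W_isometry.2 // add0r F_W.
Qed.

Lemma range_subspace : hilbert_subspace (range F).
Proof.
have [_ _ _ _] := F_polar; rewrite polar_range => ->.
apply: closure_subspace; first by exists 0 => //; rewrite linear0.
by move=> a _ _ [x _ <-] [y _ <-]; exists (a *: x + y); rewrite ?linearP.
Qed.

Lemma W_bounded : bounded_operator W.
Proof. by case: F_polar => _ _ []. Qed.

Lemma closed_span_f : closed_span (range f) = range F.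
Proof.
have -> : f = F \o e by apply/funext => i /=; rewrite F_e.
exact: closed_span_image F_bounded e_basis.2 range_subspace.
Qed.

Lemma parseval_H : exists h : nat -> H, parseval_family h.
Proof.
have [d dT] := separable_closed_span separable_H.
have HT : hilbert_subspace [set: H] by split => //; exact: closedT.
have [h ho hT] := subspace_suborthonormal dT HT.
by exists h; exact: suborthonormal_parseval.
Qed.

Lemma admissible_facts V : admissible V ->
  [/\ forall x, N x -> rnorm (V x) = rnorm x,
      forall x, orthocompl N x -> V x = 0,
      forall x, rnorm (V x + W x) = rnorm x &
      forall x, V (A x) + W (A x) = F x].
Proof.
move=> [Vp Vi VW]; rewrite polar_ker in Vi.
have [VN VNc] := partial_isometry_elim N_subspace Vp Vi.
split=> // x.
  have [p [q [Np Nq ->]]] := subspace_split x N_subspace.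
  rewrite !linearD /= (VNc _ Nq) (W_isometry.2 _ Np) addr0 add0r.
  apply/eqP; rewrite -(@eqrXn2 _ 2) ?rnorm_ge0 // !pythagoras //.
    by rewrite VN // W_isometry.1.
  exact: orthocompl_inner Np Nq.
rewrite VNc ?add0r ?F_W // -polar_ker => y Ay.
by rewrite A_sym Ay inner0r.
Qed.

Lemma admissible_intro (V : {linear l2 R -> H}) :
  (forall x, N x -> rnorm (V x) = rnorm x) ->
  (forall x, orthocompl N x -> V x = 0) ->
  (forall x y, N x -> orthocompl N y -> inner (V x) (W y) = 0) -> admissible V.
Proof.
move=> VN VNc VW; have [Vp Vi] := partial_isometry_intro N_subspace VN VNc.
split=> //; first by rewrite polar_ker.
move=> x y; have [p [q [Np Nq ->]]] := subspace_split x N_subspace.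
have [p' [q' [Np' Nq' ->]]] := subspace_split y N_subspace.
by rewrite (linearD V) (linearD W) /= (VNc _ Nq) (W_isometry.2 _ Np') addr0 add0r VW.
Qed.

Lemma admissible_orthonormal V : admissible V ->
  orthonormal_family setT (fun i => (V \+ W) (e i)).
Proof.
move=> /admissible_facts[_ _ Un _] i j _ _.
have HT : hilbert_subspace [set: l2 R] by split => //; exact: closedT.
rewrite (@isometry_inner _ _ _ (V \+ W) setT HT (fun x _ => Un x)) //.
exact: e_basis.1.
Qed.

(** With U = V + W, U e_k - f_k = U (e_k - A e_k) and U is isometric; in particular all choices of V
    give the same distance. *)
Lemma admissible_distance V : admissible V ->
  sqr_distance (fun i => (V \+ W) (e i)) f =
  (limn (series (fun k => rnorm (e k - A (e k)) ^+ 2)))%:E.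
Proof.
move=> /admissible_facts[_ _ Un UA]; rewrite -(limn_square_norm IA_e).
rewrite /sqr_distance; apply: eq_eseriesr => k _; congr (_ ^+ 2)%:E.
by rewrite -F_e -UA -[in RHS]Un !linearB /= opprD addrACA.
Qed.

(** [G] is the trace of D A D^*. The equality case is stated for [G <= 0] because this is the
    inequality that minimality delivers. *)
Lemma orthonormal_gap V (M : {linear l2 R -> H}) : admissible V ->
  (forall x, rnorm (M x) = rnorm x) ->
  square_norm_summable (fun k => M (e k) - f k) ->
  exists2 G : R, 0 <= G &
    sqr_distance (fun k => M (e k)) f =
      (limn (series (fun k => rnorm (e k - A (e k)) ^+ 2)) + G)%:E /\
    (G <= 0 -> forall x, M (A x) = F x).
Proof.
move=> adV Mn sM; have [_ _ Un UA] := admissible_facts adV.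
pose U : {linear l2 R -> H} := V \+ W.
have bounded1 (T : {linear l2 R -> H}) : (forall x, rnorm (T x) = rnorm x) ->
    bounded_operator T.
  by move=> Tn; apply/bounded_rnormP; exists 1 => // x; rewrite Tn mul1r.
have [Ms MMs] := adjoint_exists (bounded1 M Mn).
have [Us UUs] := adjoint_exists (bounded1 U Un).
have [h hp] := parseval_H.
have UAf k : U (A (e k)) = f k by rewrite -F_e -UA.
have sX : square_norm_summable (fun k => M (e k) - U (A (e k))).
  by under eq_fun do rewrite UAf.
have [cG lX] := hs_gap e_parseval hp MMs UUs A_sym Mn Un IA_e sX.
set g := fun k => complex.Re _ in cG lX.
have g0 k : 0 <= g k.
  by have := A_positive (Ms (h k) - Us (h k)); rewrite lecE => /andP[].
have ndg : nondecreasing_seq (series g).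
  by apply: nondecreasing_series => k _ _; exact: g0.
have gle n : series g n <= limn (series g) by exact: nondecreasing_cvgn_le.
exists (limn (series g)); first by have := gle 0; rewrite /series /= big_geq.
split.
  rewrite -lX -(limn_square_norm sX) /sqr_distance.
  by under [RHS]eq_eseriesr do rewrite UAf.
move=> G0 x.
have gk k : g k = 0.
  apply/eqP; rewrite eq_le g0 andbT; apply: le_trans (le_trans (gle k.+1) G0).
  rewrite /series /= big_nat_recr //= lerDr sumr_ge0 // => i _; exact: g0.
rewrite -UA -[V _ + W _]/(U (A x)).
(* By Parseval it suffices to test against each h_k: <M A x - U A x, h_k> = <x, A d_k>, and A d_k =
   0 because the positive form vanishes at d_k. *)
apply/eqP; rewrite -subr_eq0 -rnorm_eq0 -sqrf_eq0 -eqe -hp.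
rewrite eseries0 // => k _ _; rewrite innerBl MMs UUs -innerBr A_sym.
by rewrite (positive_null A_positive (gk k)) inner0r rnorm0 expr0n.
Qed.

Lemma admissible_symmetric V : admissible V ->
  symmetric_orthogonalization f (fun i => (V \+ W) (e i)).
Proof.
move=> adV; have nuo := admissible_orthonormal adV; split.
- exists (closed_span (range (fun i => (V \+ W) (e i)))) => //.
  exact: closed_span_subspace.
- move=> mu muo; have [M [Me Mn]] := isometry_exists e_basis muo.
  (* A competitor at infinite distance satisfies the inequality at once; the trace formula is
     applied to the others. *)
  have [sM|] := boolP ((sqr_distance mu f < +oo)%E); last first.
    by rewrite -leNgt leye_eq => /eqP ->; exact: leey.
  have muE : mu = (fun k => M (e k)) by apply/funext => k; rewrite Me.
  rewrite muE in sM *; have [G G0 [-> _]] := orthonormal_gap adV Mn sM.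
  by rewrite (admissible_distance adV) lee_fin lerDl.
- by rewrite (admissible_distance adV) ltry.
Qed.

(** [V] is only a reference: comparison with its distance forces [G <= 0] for [nu], so M A = F = W A
    and M = W off the kernel. Then M - W is the required partial isometry, orthogonal to W because M
    preserves the orthogonality of N and its complement. *)
Lemma symmetric_admissible V nu : admissible V ->
  symmetric_orthogonalization f nu ->
  exists2 V', admissible V' & forall i, nu i = (V' \+ W) (e i).
Proof.
move=> adV [[L _ [nuo _]] numin nufin].
have [M [Me Mn]] := isometry_exists e_basis nuo.
have nuE : nu = (fun k => M (e k)) by apply/funext => k; rewrite Me.
rewrite nuE in nufin numin.
have [G _ [dist MA]] := orthonormal_gap adV Mn nufin.
have := numin _ (admissible_orthonormal adV).
rewrite dist (admissible_distance adV) lee_fin gerDl => /MA{}MA.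
have MW z : orthocompl N z -> M z = W z.
  by move=> /orthocompl_ker_range[x <-]; rewrite MA F_W.
have HT : hilbert_subspace [set: l2 R] by split => //; exact: closedT.
pose V' : {linear l2 R -> H} := M \- W.
exists V'; last by move=> i; rewrite nuE /= subrK.
apply: admissible_intro => [x Nx|x Nx|x y Nx Ny] /=.
- by rewrite W_isometry.2 // subr0 Mn.
- by rewrite MW // subrr.
- rewrite (W_isometry.2 _ Nx) subr0 -MW // (@isometry_inner _ _ _ M setT) //.
  exact: orthocompl_inner Nx Ny.
Qed.

(** * The dimension condition *)

Let dim_condition := hilbert_dim_le (ker_op F) (orthocompl (range F)).

Lemma ker_basis_finite (B : set (l2 R)) : orthonormal_basis N B id -> finite_set B.
Proof.
move=> [Bo BN].
have QQ : is_adjoint (idfun \- A) (idfun \- A).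
  by move=> x y /=; rewrite innerBl innerBr A_sym.
apply: (hs_fixed_orthonormal_finite QQ e_parseval IA_e Bo) => x Bx /=.
have : ker_op A x.
  by rewrite polar_ker -BN; apply: closed_span_subset; exists x.
by move=> ->; rewrite subr0.
Qed.

(** V sends the kernel basis injectively into an orthonormal basis of the complement of the range;
    finiteness of the kernel basis makes it a finite sum. *)
Lemma dim_condition_admissible : dim_condition -> exists V, admissible V.
Proof.
move=> [B [C [Bb [Co Cspan] BC]]].
have /finite_seqP[s0 s0E] := ker_basis_finite Bb.
have [phi [phiC phi_inj]] := card_le_function 0 BC.
pose s := undup s0; have su : uniq s := undup_uniq s0.
have sE : B = [set` s].
  by rewrite s0E; apply/seteqP; split=> x /=; rewrite mem_undup.
have [Bo Bspan] := Bb; rewrite sE in Bo Bspan phiC phi_inj.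
have phio : orthonormal_family [set` s] phi.
  move=> a b sa sb; rewrite Co; try exact: phiC.
  by congr (nat_of_bool _)%:R; apply/eqP/eqP => [|->//]; exact: phi_inj.
have [|V VE] := @linear_of_fun _ H (l2 R) (fun x => \sum_(a <- s) inner x a *: phi a).
  move=> c x y; rewrite scaler_sumr -big_split; apply: eq_bigr => a _.
  by rewrite innerDl innerZl scalerDl scalerA.
exists V; apply: admissible_intro => [x Nx|x Nx|x y Nx Ny].
- apply/eqP; rewrite -(@eqrXn2 _ 2) ?rnorm_ge0 // VE.
  have Bx : closed_span (id @` [set` s]) x by rewrite Bspan.
  rewrite [X in _ == rnorm X ^+ 2](finite_orthonormal_expansion su Bo Bx).
  by rewrite (finite_orthonormal_norm su phio) (finite_orthonormal_norm su Bo).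
- rewrite VE big_seq big1 // => a sa.
  have Na : N a by rewrite -[N]Bspan; apply: closed_span_subset; exists a.
  by rewrite Nx ?scale0r.
- rewrite VE inner_suml big_seq big1 // => a sa.
  have : closed_span (id @` C) (phi a).
    by apply: closed_span_subset; exists (phi a) => //; exact: phiC.
  rewrite Cspan -polar_range innerZl => ->; [by rewrite mulr0|by exists y].
Qed.

Lemma symmetric_dim_condition nu : symmetric_orthogonalization f nu -> dim_condition.
Proof.
move=> [[L _ [nuo _]] _ nufin].
have [M [Me Mn]] := isometry_exists e_basis nuo.
have M_bounded : bounded_operator M.
  by apply/bounded_rnormP; exists 1 => // x; rewrite Mn mul1r.
have [Ms MMs] := adjoint_exists M_bounded.
have HT : hilbert_subspace [set: l2 R] by split => //; exact: closedT.
have MsM x : Ms (M x) = x.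
  apply: inner_inj => z; rewrite innerC -MMs -innerC.
  exact: (@isometry_inner _ _ _ M setT).
have [Fs FFs] := adjoint_exists F_bounded.
have [d dT] := separable_closed_span separable_H.
have [h ho hN] := subspace_suborthonormal e_basis.2 N_subspace.
have [g go gF] := subspace_suborthonormal dT (orthocompl_subspace (range F)).
have Bb := suborthonormal_basis ho; have Cb := suborthonormal_basis go.
rewrite hN in Bb; rewrite gF in Cb.
set B := range h `\ 0 in Bb; set C := range g `\ 0 in Cb.
exists B, C; split => //.
have /finite_seqP[s0 s0E] := ker_basis_finite Bb.
(* The kernel basis is finite, so it embeds in any infinite [C]; the substance lies in the case
   where both are finite. *)
have [Cfin|Cinf] := pselect (finite_set C); last first.
  apply: (card_le_trans (B := [set: nat])); last exact/infiniteP.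
  by apply: finite_set_countable; exact: ker_basis_finite Bb.
have /finite_seqP[t0 t0E] := Cfin.
pose s := undup s0; have su : uniq s := undup_uniq s0.
pose t := undup t0; have tu : uniq t := undup_uniq t0.
have sE : B = [set` s].
  by rewrite s0E; apply/seteqP; split=> x /=; rewrite mem_undup.
have tE : C = [set` t].
  by rewrite t0E; apply/seteqP; split=> x /=; rewrite mem_undup.
have [|ts] := leqP (size s) (size t); first exact: (card_le_seq 0 0 tu sE tE).
exfalso; have [Bo Bspan] := Bb; have [Co Cspan] := Cb.
rewrite sE in Bo Bspan; rewrite tE in Co Cspan.
pose a i := nth 0 s i; pose b i := nth 0 t i.
have as_ i : (i < size s)%N -> N (a i).
  move=> is_; rewrite -Bspan; apply: closed_span_subset; exists (a i) => //.
  exact: mem_nth.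
have ao i j : (i < size s)%N -> (j < size s)%N -> inner (a i) (a j) = (i == j)%:R.
  by move=> si sj; rewrite (Bo _ _ (mem_nth _ si) (mem_nth _ sj)) nth_uniq.
pose r := iota 0 (size t).
have rE : [set` r] = `I_(size t) by apply/seteqP; split=> i /=; rewrite mem_iota.
have bo : orthonormal_family [set` r] b.
  move=> i j; rewrite rE => /= ti tj.
  by rewrite (Co _ _ (mem_nth _ ti) (mem_nth _ tj)) nth_uniq.
have ao' : orthonormal_family [set` r] a.
  move=> i j; rewrite rE => /= ti tj; apply: ao; exact: ltn_trans ts.
have ru : uniq r := iota_uniq 0 (size t).
(* [S] carries the first [size t] kernel vectors to a basis of the complement of the range, so F + S
   becomes onto. The next kernel vector [a (size t)], available since [size t < size s], is still
   killed. *)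
pose S x := \sum_(i <- r) inner x (a i) *: b i.
pose Ss y := \sum_(i <- r) inner y (b i) *: a i.
have SSs x y : inner (S x) y = inner x (Ss y).
  rewrite inner_suml inner_sumr; apply: eq_bigr => i _.
  by rewrite innerZl innerZr -innerC mulrC.
have [|T TE] := @linear_of_fun _ (l2 R) (l2 R) (fun x => Ms (F x + S x)).
  move=> c x y; rewrite -linearP; congr (Ms _).
  rewrite linearP scalerDr addrACA; congr (_ + _).
  rewrite /S scaler_sumr -big_split; apply: eq_bigr => i _.
  by rewrite innerDl innerZl scalerDl scalerA.
have TTs x y : inner (T x) y = inner x (Fs (M y) + Ss (M y)).
  by rewrite TE innerC -MMs -innerC innerDl FFs SSs innerDr.
(* As Ms M = I, e_k - T e_k = Ms ((nu_k - f_k) - S e_k): here Ms is a contraction, nu is at finite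
   distance from f, and S has finite rank. *)
have sT : square_norm_summable (fun k => e k - T (e k)).
  apply: (square_norm_summable_le (c := 1)
    (x := fun k => (nu k - f k) - S (e k))) => [k|].
    rewrite mul1r TE -{1}[e k]MsM -linearB Me -F_e opprD addrA.
    exact: isometry_adjoint_le MMs Mn _.
  apply: square_norm_summableB => //.
  by apply: square_norm_summable_sum => i; exact: square_norm_summable_rank1.
have surjT y : exists x, T x = y.
  (* Split M y into F x0 and a part q orthogonal to the range. In x1 + Ss q, the vector x1 is x0
     without its kernel component, so S ignores it, and Ss q lies in the kernel, so F ignores it. *)
  have [p [q [[x0 _ <-] Fq MyE]]] := subspace_split (M y) range_subspace.
  have [p0 [x1 [Np0 Nx1 x0E]]] := subspace_split x0 N_subspace.
  exists (x1 + Ss q); rewrite TE -[RHS]MsM MyE; congr (Ms (_ + _)).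
    rewrite x0E !linearD /= (Np0 : F p0 = 0) add0r linear_sum big_seq big1 ?addr0 //.
    move=> i; rewrite mem_iota /= => it; rewrite linearZ /= (as_ i) ?scaler0 //.
    exact: ltn_trans ts.
  have qE : closed_span (b @` [set` r]) q.
    rewrite -[orthocompl _]Cspan in Fq.
    apply: closed_spanS Fq => _ [x /= xt <-].
    exists (index x t); last by rewrite /b nth_index.
    by rewrite /= mem_iota /= index_mem.
  rewrite [RHS](finite_orthonormal_expansion ru bo qE) /S big_seq [RHS]big_seq.
  apply: eq_bigr => i ir; congr (_ *: _); rewrite innerDl.
  rewrite (finite_orthonormal_coef ru ao' (fun i => inner q (b i)) ir).
  rewrite (inner_eq0C (orthocompl_inner _ Nx1)) ?add0r //.
  by move: ir; rewrite mem_iota /= => it; apply: as_; exact: ltn_trans ts.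
have Ta : T (a (size t)) = 0.
  rewrite TE (as_ _ ts) add0r /S big_seq big1 ?linear0 // => i.
  rewrite mem_iota /= => it; rewrite ao ?(ltn_trans it) // gtn_eqF ?scale0r //.
have := ao _ _ ts ts.
rewrite (hs_perturbation_injective TTs e_parseval sT surjT Ta) inner0l eqxx => /eqP.
by rewrite eq_sym oner_eq0.
Qed.

(** * Trivial kernel: uniqueness and equality of spans *)

Lemma ker_trivial_admissible : N = [set 0] -> exists V, admissible V.
Proof.
move=> N0; have [|V V0] := @linear_of_fun _ H (l2 R) (fun=> 0).
  by move=> a x y; rewrite scaler0 addr0.
exists V; apply: admissible_intro => [x|x _|x y _ _]; rewrite V0 //.
  by rewrite N0 => ->; rewrite !rnorm0.
by rewrite inner0l.
Qed.

Lemma ker_trivial_admissible0 V : N = [set 0] -> admissible V -> forall x, V x = 0.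
Proof.
move=> N0 /admissible_facts[_ VNc _ _] x; apply: VNc => y.
by rewrite N0 => ->; rewrite inner0r.
Qed.

Lemma admissible0_ker_trivial V : admissible V -> (forall i, V (e i) = 0) ->
  N = [set 0].
Proof.
move=> adV Ve; have [VN _ _ _] := admissible_facts adV.
have [[Vb _] _ _] := adV.
apply/seteqP; split=> x; last by move=> ->; rewrite /N /ker_op /= linear0.
by move=> /VN; rewrite (bounded_eq0 Vb e_basis.2 Ve) rnorm0 => /esym/eqP;
  rewrite rnorm_eq0 => /eqP.
Qed.

Lemma ker_trivial_symmetric nu : N = [set 0] ->
  symmetric_orthogonalization f nu -> forall i, nu i = W (e i).
Proof.
move=> N0 nus i; have [V0 adV0] := ker_trivial_admissible N0.
have [V adV ->] := symmetric_admissible adV0 nus.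
by rewrite /= (ker_trivial_admissible0 N0 adV) add0r.
Qed.

Lemma ker_trivial_symmetric_W : N = [set 0] ->
  symmetric_orthogonalization f (fun i => W (e i)).
Proof.
move=> N0; have [V adV] := ker_trivial_admissible N0.
rewrite (_ : (fun i => W (e i)) = (fun i => (V \+ W) (e i))).
  exact: admissible_symmetric.
by apply/funext => i /=; rewrite (ker_trivial_admissible0 N0 adV) add0r.
Qed.

Lemma symmetric_representation nu : symmetric_orthogonalization f nu ->
  exists2 V, admissible V & forall i, nu i = (V \+ W) (e i).
Proof.
move=> nus; have [V0 adV0] := dim_condition_admissible (symmetric_dim_condition nus).
exact: symmetric_admissible adV0 nus.
Qed.

(** Source of a second symmetric orthogonalization: those of V and -V differ unless V vanishes on
    the basis [e], hence on the kernel where it is isometric. *)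
Lemma admissible_opp V : admissible V ->
  exists2 V', admissible V' & forall x, V' x = - V x.
Proof.
move=> adV; have [VN VNc _ _] := admissible_facts adV.
exists (\- V) => //; apply: admissible_intro => [x Nx|x Nx|x y _ _] /=.
- by rewrite rnormN VN.
- by rewrite VNc // oppr0.
- by case: adV => _ _ VW; rewrite innerNl VW oppr0.
Qed.

Lemma unique_symmetric_ker :
  (exists! nu, symmetric_orthogonalization f nu) <-> N = [set 0].
Proof.
split=> [[nu [nus nuU]]|N0]; last first.
  exists (fun i => W (e i)); split; first exact: ker_trivial_symmetric_W.
  by move=> nu nus; apply/funext => i; rewrite (ker_trivial_symmetric N0 nus).
have [V adV nuV] := symmetric_representation nus.
apply: (admissible0_ker_trivial adV) => i.
have [V' adV' V'E] := admissible_opp adV.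
have /(congr1 (fun u => u i)) := nuU _ (admissible_symmetric adV').
rewrite nuV /= V'E => /addIr /eqP; rewrite -addr_eq0 -mulr2n -scaler_nat.
by rewrite scaler_eq0 pnatr_eq0 => /eqP.
Qed.

Lemma span_symmetric_ker : N = [set 0] <->
  exists2 nu, symmetric_orthogonalization f nu &
    closed_span (range nu) = closed_span (range f).
Proof.
split=> [N0|[nu nus nuf]].
  exists (fun i => W (e i)); first exact: ker_trivial_symmetric_W.
  rewrite closed_span_f -polar_range.
  apply: (closed_span_image W_bounded e_basis.2).
  by rewrite polar_range; exact: range_subspace.
have [V adV nuV] := symmetric_representation nus.
apply: (admissible0_ker_trivial adV) => i.
have [_ _ VW] := adV.
(* If the spans agree, V e_i lies in the range of W, to which it is also orthogonal. *)
have : range W (V (e i)).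
  rewrite (_ : V (e i) = nu i - W (e i)); last by rewrite nuV addrK.
  rewrite polar_range; apply: (subspaceB range_subspace).
    by rewrite -closed_span_f -nuf; apply: closed_span_subset; exists i.
  by rewrite -polar_range; exists (e i).
by move=> [y _ Wy]; apply: inner_self_eq0; rewrite -{2}Wy VW.
Qed.

(** * Trivial kernel: Schauder basis and frame inequalities *)

Lemma series_F (c : nat -> R[i]) n :
  F (series (fun k => c k *: e k) n) = series (fun k => c k *: f k) n.
Proof.
by rewrite /series /= linear_sum; apply: eq_bigr => k _; rewrite linearZ /= F_e.
Qed.

Lemma e_expansion x : series (fun k => inner x (e k) *: e k) @ \oo --> x.
Proof.
apply: suborthonormal_expansion; last by rewrite e_basis.2.
exact: orthonormal_suborthonormal e_basis.1.
Qed.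

Lemma closed_span_f_mem i : closed_span (range f) (f i).
Proof. by apply: closed_span_subset; exists i. Qed.

(** F maps the Fourier series of a kernel vector to an expansion of 0 along [f]; uniqueness of
    coefficients forces all its Fourier coefficients to vanish. *)
Lemma schauder_ker_trivial : schauder_basis (closed_span (range f)) f -> N = [set 0].
Proof.
move=> [_ fU]; apply/seteqP; split=> x; last by move=> ->; rewrite /N /ker_op /= linear0.
move=> Fx; have [c [_ cU]] := fU 0 (subspace0 (closed_span_subspace _)).
have c0 : c = fun=> 0.
  apply: cU; rewrite (_ : series _ = fun=> 0); first exact: cvg_cst.
  by apply/funext => n; rewrite /series /= big1 // => k _; rewrite scale0r.
have cx : c = fun k => inner x (e k).
  apply: cU; have := bounded_cvg F_bounded (@e_expansion x).
  by rewrite (Fx : F x = 0); under eq_fun do rewrite series_F.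
apply: (orthocompl_disjoint (L := setT)) => //; rewrite -e_basis.2.
apply: orthocompl_closed_span => _ [i _ <-].
by have := congr1 (fun u => u i) cx; rewrite c0.
Qed.

Lemma ker_trivial_bounded_below : N = [set 0] ->
  exists2 c : R, 0 < c & forall x, rnorm x <= c * rnorm (F x).
Proof.
move=> N0; have [c c0 cF] := polar_bounded_below.
exists c => // x; apply: cF => y; rewrite N0 => ->; exact: inner0r.
Qed.

(** The sum of |<x, f_j>|^2 is |F^* x|^2, so the upper constant is the square of a bound of F. For
    the lower one write x = F y: |x|^2 = <y, F^* x> <= c |x| |F^* x|. *)
Lemma ker_trivial_frame : N = [set 0] -> frame (closed_span (range f)) f.
Proof.
move=> N0; split; first exact: closed_span_f_mem.
have [c c0 cF] := ker_trivial_bounded_below N0.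
have [Fs FFs] := adjoint_exists F_bounded.
have [M M0 FM] := (bounded_rnormP F).1 F_bounded.
have FsM := adjoint_bounded (ltW M0) FFs FM.
have sumE x : (\sum_(0 <= j <oo) (rnorm (inner x (f j)) ^+ 2)%:E =
    (rnorm (Fs x) ^+ 2)%:E)%E.
  rewrite -e_parseval; apply: eq_eseriesr => k _; congr (_ ^+ 2)%:E.
  by rewrite -F_e innerC FFs -innerC.
exists ((c ^+ 2)^-1), (M ^+ 2); split; rewrite ?invr_gt0 ?exprn_gt0 // => x.
rewrite closed_span_f sumE !lee_fin => -[y _ yx].
rewrite -exprMn ler_pXn2r ?nnegrE ?rnorm_ge0 ?mulr_ge0 ?rnorm_ge0 ?(ltW M0) //.
rewrite FsM andbT mulrC ler_pdivrMr ?exprn_gt0 // -exprMn.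
rewrite ler_pXn2r ?nnegrE ?rnorm_ge0 ?mulr_ge0 ?rnorm_ge0 ?(ltW c0) //.
have [->|x0] := eqVneq x 0; first by rewrite rnorm0 mulr_ge0 ?rnorm_ge0 ?ltW.
rewrite -(ler_pM2r (_ : 0 < rnorm x)) ?rnorm_gt0 // -expr2 rnorm_Re -{2}yx.
rewrite Re_innerC FFs; apply: le_trans (ler_norm _) _.
apply: le_trans (ler_Re_rnorm _) _; apply: le_trans (cauchy_schwarz _ _) _.
rewrite mulrC -mulrA ler_wpM2l ?rnorm_ge0 // -yx; exact: cF.
Qed.

Lemma ker_trivial_schauder : N = [set 0] -> schauder_basis (closed_span (range f)) f.
Proof.
move=> N0; split; first exact: closed_span_f_mem.
have [c c0 cF] := ker_trivial_bounded_below N0.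
rewrite closed_span_f => _ [y _ <-]; exists (fun k => inner y (e k)); split.
  by have := bounded_cvg F_bounded (@e_expansion y); under eq_fun do rewrite series_F.
move=> c' /cvg_rnormP c'y.
(* The lower bound on F pulls the convergence of the sums of c'_k f_k back to l_2, where
   coefficients are read off by inner products with e_j. *)
have sy : series (fun k => c' k *: e k) @ \oo --> y.
  apply/cvg_rnormP => eps eps0; have [|n0 n0P] := c'y (eps / c).
    by rewrite divr_gt0.
  exists n0 => n /n0P; rewrite ltr_pdivlMr // mulrC; apply: le_lt_trans.
  by apply: le_trans (cF _) _; rewrite linearB /= series_F.
apply/funext => j; apply: (inner_cvg sy); exists j.+1 => n jn.
have eo := orthonormal_suborthonormal e_basis.1.
rewrite (suborthonormal_partial _ eo jn); have := e_basis.1 j j I I.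
by rewrite eo eqxx /= => ->; rewrite mulr1.
Qed.

End symmetric_orthogonalizations.

Theorem theorem3p6 (R : realType) (H : hilbertType R)
    (f : nat -> H) (e : nat -> l2 R)
    (F W : {linear l2 R -> H}) (absF : {linear l2 R -> l2 R})
    (separable_H : separable H)
    (f_indep : linearly_independent f)
    (e_basis : orthonormal_basis setT setT e)
    (F_e : forall i, F (e i) = f i)
    (F_bounded : bounded_operator F)
    (F_polar : polar_decomposition F W absF)
    (IabsF_HS : hilbert_schmidt (idfun \- absF)) :
  let admissible (V : {linear l2 R -> H}) :=
    [/\ partial_isometry V, initial_space V = ker_op absF
      & forall x y, inner (V x) (W y) = 0] in
  let dim_condition := hilbert_dim_le (ker_op F) (orthocompl (range F)) in
  [/\ ((exists nu, symmetric_orthogonalization f nu) <-> dim_condition) /\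
      (dim_condition ->
        [/\ range W = range F,
            forall V, admissible V ->
              symmetric_orthogonalization f (fun i => (V \+ W) (e i))
          & forall nu, symmetric_orthogonalization f nu ->
              exists2 V, admissible V & forall i, nu i = (V \+ W) (e i)]),
      [/\ (exists! nu, symmetric_orthogonalization f nu) <->
            ker_op F = [set 0],
          ker_op F = [set 0] <->
            (exists2 nu, symmetric_orthogonalization f nu
              & closed_span (range nu) = closed_span (range f))
        & ker_op F = [set 0] ->
            (forall nu, symmetric_orthogonalization f nu ->
              forall i, nu i = W (e i)) /\
            (forall V, admissible V -> forall x, V x = 0)]
    & frame (closed_span (range f)) f /\ riesz_basis (closed_span (range f)) f
        <-> ker_op F = [set 0]].
Proof.
move=> admissible dim_condition.
split; [split|split|].
- split=> [[nu]|].
    exact: (symmetric_dim_condition separable_H e_basis F_e F_bounded F_polar IabsF_HS).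
  move=> /(dim_condition_admissible e_basis F_bounded F_polar IabsF_HS)[V adV].
  exists (fun i => (V \+ W) (e i)).
  exact: (admissible_symmetric separable_H e_basis F_e F_bounded F_polar IabsF_HS adV).
- move=> /(dim_condition_admissible e_basis F_bounded F_polar IabsF_HS)[V0 adV0]; split.
  + exact: (polar_range e_basis F_bounded F_polar IabsF_HS).
  + exact: (admissible_symmetric separable_H e_basis F_e F_bounded F_polar IabsF_HS).
  + move=> nu.
    exact: (symmetric_admissible separable_H e_basis F_e F_bounded F_polar IabsF_HS adV0).
- exact: (unique_symmetric_ker separable_H e_basis F_e F_bounded F_polar IabsF_HS).
- exact: (span_symmetric_ker separable_H e_basis F_e F_bounded F_polar IabsF_HS).
- move=> N0; split.
    move=> nu.
    exact: (ker_trivial_symmetric separable_H e_basis F_e F_bounded F_polar IabsF_HS N0).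
  by move=> V adV; exact: (ker_trivial_admissible0 F_bounded F_polar N0 adV).
- split=> [[_ [fS _]]|N0].
    exact: (schauder_ker_trivial e_basis F_e F_bounded fS).
  have fF := ker_trivial_frame e_basis F_e F_bounded F_polar IabsF_HS N0.
  split=> //; split=> //.
  exact: (ker_trivial_schauder e_basis F_e F_bounded F_polar IabsF_HS N0).
Qed.
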